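(* Let $R\geq 4$ be an even integer and, for each integer $l\geq1$, let $\alpha_l\in(0,1)$ be the number whose negative continued fraction expansion is periodic with period block consisting of $R+1$ followed by $l$ copies of $R$, i.e. $\alpha_l=[0;\overline{R+1,R,\ldots,R}]^-$. Then $$\lim_{l\to\infty}\rho(\alpha_l)=C(R):=\frac{(1-2\delta)(1-\beta)}{4(1-\delta\beta)}=\frac14\cdot\frac{R-2}{\sqrt{R^2-4}+1},$$ where $\beta=\frac12(R-\sqrt{R^2-4})$ and $\delta=\frac{1}{R+1-\beta}$.
   Context: For real $x$, $\|x\|$ denotes the distance from $x$ to the nearest integer. For irrational $\alpha$ and real $\gamma$, $M(\alpha,\gamma):=\liminf_{|n|\to\infty}|n|\,\|n\alpha-\gamma\|$, and $\rho(\alpha):=\sup_{\gamma\notin\mathbb{Z}+\alpha\mathbb{Z}}M(\alpha,\gamma)$. The negative continued fraction expansion $[0;a_1,a_2,\ldots]^-$ means $\alpha=\cfrac{1}{a_1-\cfrac{1}{a_2-\cdots}}$ with integers $a_i\geq2$ generated by $\alpha_0=\alpha$, $a_{n+1}=\lceil 1/\alpha_n\rceil$, $\alpha_{n+1}=\lceil1/\alpha_n\rceil-1/\alpha_n$; an overline denotes a repeating block. *)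

(* Defs.v *)
From Stdlib Require Import Reals ZArith.
From Coquelicot Require Import Coquelicot.
Open Scope R_scope.

Definition floorZ (x : R) : Z := Int_part x.
Definition ceilZ (x : R) : Z := (- Int_part (- x))%Z.

Definition dnint (x : R) : R :=
  Rmin (x - IZR (floorZ x)) (IZR (floorZ x) + 1 - x).

Definition tail_inf (a g : R) (N : nat) : Rbar :=
  Rbar_glb (fun y : Rbar => exists n : Z,
    (Z.of_nat N <= Z.abs n)%Z /\ y = Finite (Rabs (IZR n) * dnint (IZR n * a - g))).

(* M(a,g) = liminf_{|n| -> oo} |n| ||n a - g|| = sup_N tail_inf a g N *)
Definition Mag (a g : R) : Rbar :=
  Rbar_lub (fun y : Rbar => exists N : nat, y = tail_inf a g N).

Definition rho (a : R) : Rbar :=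
  Rbar_lub (fun y : Rbar => exists g : R,
    ~ (exists m n : Z, g = IZR m + a * IZR n) /\ y = Mag a g).

Fixpoint ncf_state (a : R) (n : nat) : R :=
  match n with
  | O => a
  | S k => IZR (ceilZ (/ ncf_state a k)) - / ncf_state a k
  end.

(* ncf_digit a n = a_{n+1} *)
Definition ncf_digit (a : R) (n : nat) : Z := ceilZ (/ ncf_state a n).

(* Main.v *)
Require Import Defs.
From Stdlib Require Import Reals ZArith.
From Coquelicot Require Import Coquelicot.
From Stdlib Require Import Lra Lia Psatz Classical.
Open Scope R_scope.

(** Consecutive convergents q_(k-1), q_k give a basis of the lattice { (n, n a - m) } which, after
    rescaling, is (1, al), (ab, 1) with al, ab the forward and backward expansions at stage k;
    n (n a - m - g) becomes a product of coordinates divided by 1 - al ab.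

    Upper bound: if all products |n| ||n a - g|| with |n| large exceed C + eps, then at each late stage
    the shifted lattice has a parallelogram with edges the two basis vectors and one vertex in every
    quadrant. Centres at successive stages differ by t/2 times a basis vector, with t of the parity
    of the digit. Two opposite corners force consecutive t's to cancel between two digits R, and to
    sum to +-1 next to the digit R + 1. So t alternates in sign along each block of R's, which fixes
    the centre next to R + 1 up to an error exponential in l, and there some corner has product at
    most C + o(1).

    Lower bound: take t = 1, -1, 1, ... at the digits R + 1 and t = 0 elsewhere. The corner products
    are at least C, and every lattice point is dominated by a corner at the stage where its second
    coordinate has the size of the cell. *)

(** * Inequalities for products at opposite corners *)

Lemma small_root_bounds (r b : R) : 4 <= r -> b = (r - sqrt (r ^ 2 - 4)) / 2 ->
  b * (r - b) = 1 /\ 0 < b <= 0.268.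
Proof.
intros Hr Hb.
assert (Hs : sqrt (r ^ 2 - 4) * sqrt (r ^ 2 - 4) = r ^ 2 - 4) by (apply sqrt_sqrt; nra).
assert (Hs0 := sqrt_pos (r ^ 2 - 4)).
set (s := sqrt (r ^ 2 - 4)) in *.
assert (H1 : b * (r - b) = 1) by (subst b; nra).
assert (Hsr : s < r) by nra.
assert (Hsr2 : r - 2 < s) by nra.
assert (b < 1) by lra.
assert (0 < b) by lra.
split; [exact H1|split; [lra|]].
(* [0.268] is [2 - sqrt 3] rounded up, the value of [b] in the extreme case [r = 4]. *)
destruct (Rle_or_lt b 0.268) as [|Hlt]; [lra|]. nra.
Qed.

(** The factors are [1 - ab * (1 + X)] and [1 - al * (1 + Y)]. If [1 + X] and [1 + Y] are
    nonnegative, [ab] and [al] may be lowered to [g], and the inequality of arithmetic and geometric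
    means concludes. If one of them is [- c < 0], the product is at most
    [(1 + b * c) * (1 - g * (s + c))], which [b - g <= s * b * g] brings below [1 - s * g]. *)
Lemma corner_product_le (b g s ab al X Y : R) :
  0 < g -> 3 <= s -> g <= ab <= b -> g <= al <= b -> b - g <= s * b * g ->
  s <= (1 + X) + (1 + Y) ->
  0 < 1 - ab - ab * X -> 0 < 1 - al - al * Y ->
  (1 - ab - ab * X) * (1 - al - al * Y) <= (1 - s * g / 2) ^ 2.
Proof.
assert (half : forall ab al X Y, 0 < g -> 3 <= s -> g <= ab <= b -> g <= al <= b ->
  b - g <= s * b * g -> s <= (1 + X) + (1 + Y) ->
  0 < 1 - ab - ab * X -> 0 < 1 - al - al * Y -> X < -1 ->
  (1 - ab - ab * X) * (1 - al - al * Y) <= (1 - s * g / 2) ^ 2).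
{ intros ab' al' X' Y' Hg Hs Hab Hal Hbg HXY H1 H2 HX.
  set (c := - (1 + X')).
  assert (Hc : 0 < c) by (unfold c; lra).
  assert (A1 : 1 - ab' - ab' * X' <= 1 + b * c) by (unfold c; nra).
  assert (A2 : 1 - al' - al' * Y' <= 1 - g * (s + c)).
  { assert (s + c <= 1 + Y') by (unfold c; lra). nra. }
  apply Rle_trans with ((1 + b * c) * (1 - g * (s + c))).
  { apply Rmult_le_compat; lra. }
  assert (c * (b - g - s * b * g) <= 0) by nra.
  assert (0 <= b * g * (c * c)) by (assert (0 < b * g) by nra; nra).
  nra. }
intros Hg Hs Hab Hal Hbg HXY H1 H2.
destruct (Rlt_le_dec X (-1)) as [HX|HX]; [now apply half|].
destruct (Rlt_le_dec Y (-1)) as [HY|HY].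
{ rewrite Rmult_comm. apply half; auto. lra. }
apply Rle_trans with ((1 - g * (1 + X)) * (1 - g * (1 + Y))).
{ apply Rmult_le_compat; nra. }
assert (B1 : 0 < 1 - g * (1 + X)) by nra.
assert (B2 : 0 < 1 - g * (1 + Y)) by nra.
set (P := 1 - g * (1 + X)) in *. set (P2 := 1 - g * (1 + Y)) in *.
assert (P + P2 <= 2 - s * g) by (unfold P, P2; nra).
assert (0 <= (P - P2) ^ 2) by apply pow2_ge_0.
nra.
Qed.

(** Since [al] and [ab] never exceed [b], this bounds [4 * climit b * (1 - al * ab)] from below at
    every stage. *)
Definition wmin (b : R) : R := (1 - b) ^ 2 * (1 - b ^ 2) / (1 + b - b ^ 2).

Lemma wmin_ge (b : R) : 0 < b <= 0.268 -> 1 - 3 * b + 3 * b ^ 2 <= wmin b.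
Proof.
intros Hb. unfold wmin. apply Rmult_le_reg_r with (1 + b - b ^ 2); [nra|].
replace ((1 - b) ^ 2 * (1 - b ^ 2) / (1 + b - b ^ 2) * (1 + b - b ^ 2))
  with ((1 - b) ^ 2 * (1 - b ^ 2)) by (field; nra).
(* With the denominator cleared, the sides differ by [b ^ 2] times this quadratic, whose smaller
   root [1 - sqrt 2 / 2] exceeds [0.268]. *)
assert (0 <= 1 - 4 * b + 2 * b ^ 2) by nra.
assert (0 <= b ^ 2 * (1 - 4 * b + 2 * b ^ 2)) by (apply Rmult_le_pos; nra).
nra.
Qed.

Lemma inv_digit_bounds (r b : R) : b * (r - b) = 1 -> 0 < b ->
  / r = b / (1 + b ^ 2) /\ / (r + 1) = b / (1 + b + b ^ 2).
Proof.
intros H Hb. assert (Hr : r = b + / b) by (apply Rmult_eq_reg_l with b; [field_simplify; nra|lra]).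
subst r. split; field; repeat split; nra.
Qed.

(** Supplies [corner_product_le] between two digits [r], with [g = / r]. The value [s = 3] will
    exclude sums of consecutive steps of modulus at least 2; next to [r + 1] only [g = / (r + 1)] is
    available, and [s = 4] excludes modulus at least 3. *)
Lemma even_corner_lt (r b : R) : b * (r - b) = 1 -> 0 < b <= 0.268 ->
  b - / r <= 3 * b * / r /\ (1 - 3 * / r / 2) ^ 2 <= wmin b.
Proof.
intros H Hb. destruct (inv_digit_bounds r b H) as [E _]; [lra|]. rewrite E.
set (g := b / (1 + b ^ 2)).
assert (Hg : g * (1 + b ^ 2) = b) by (unfold g; field; nra).
assert (Hg0 : 0 < g) by (unfold g; apply Rdiv_lt_0_compat; nra).
split. { nra. }
apply Rle_trans with (2 := wmin_ge b Hb).
assert (g = b - g * b ^ 2) by lra.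
assert (g <= b) by nra.
assert (b * 0.93 <= g) by nra.
nra.
Qed.

Lemma odd_corner_lt (r b : R) : b * (r - b) = 1 -> 0 < b <= 0.268 ->
  b - / (r + 1) <= 4 * b * / (r + 1) /\ (1 - 4 * / (r + 1) / 2) ^ 2 <= wmin b.
Proof.
intros H Hb. destruct (inv_digit_bounds r b H) as [_ E]; [lra|]. rewrite E.
set (g := b / (1 + b + b ^ 2)).
assert (Hg : g * (1 + b + b ^ 2) = b) by (unfold g; field; nra).
assert (Hg0 : 0 < g) by (unfold g; apply Rdiv_lt_0_compat; nra).
split. { nra. }
apply Rle_trans with (2 := wmin_ge b Hb).
assert (g <= b) by nra.
assert (b - b ^ 2 <= g) by nra.
apply Rle_trans with ((1 - 2 * (b - b ^ 2)) ^ 2).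
{ apply pow_incr. nra. }
nra.
Qed.

(** Eliminating [y] leaves [w * p < q * (p ^ 2 - x ^ 2)]. Both sides of the box are at most
    [m = 1 - b + b ^ 2], and [m ^ 2 - w <= / 4]. *)
Lemma half_box (r b p q x y : R) : b * (r - b) = 1 -> 0 < b <= 0.268 ->
  0 < p <= 1 - / (r + 1) -> 0 < q <= 1 - / (r + 1) ->
  Rabs x < p -> Rabs y < q ->
  wmin b < (p - x) * (q - y) -> wmin b < (p + x) * (q + y) ->
  Rabs x <= / 2.
Proof.
intros H Hb Hp Hq Hx Hy H1 H2.
destruct (inv_digit_bounds r b H) as [_ E]; [lra|]. rewrite E in *.
set (g := b / (1 + b + b ^ 2)) in *.
assert (Hg : g * (1 + b + b ^ 2) = b) by (unfold g; field; nra).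
assert (Hg0 : 0 < g) by (unfold g; apply Rdiv_lt_0_compat; nra).
assert (b - b ^ 2 <= g) by nra.
assert (HW := wmin_ge b Hb). set (w := wmin b) in *.
apply Rabs_def2 in Hx. apply Rabs_def2 in Hy.
(* Adding the two inequalities divided by [p - x] and [p + x] eliminates [y]. *)
assert (K : w * p < q * (p ^ 2 - x ^ 2)).
{ assert (w * (p + x) < (p - x) * (q - y) * (p + x)) by (apply Rmult_lt_compat_r; lra).
  assert (w * (p - x) < (p + x) * (q + y) * (p - x)) by (apply Rmult_lt_compat_r; lra).
  nra. }
assert (Hp2 : p <= 1 - b + b ^ 2) by lra.
assert (Hq2 : q <= 1 - b + b ^ 2) by lra.
assert (Hw : 0 < w) by nra.
assert (W1 : (1 - b + b ^ 2) ^ 2 - w <= / 4).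
{ apply Rle_trans with (b - 2 * b ^ 3 + b ^ 4); [nra|]. nra. }
set (m := 1 - b + b ^ 2) in *.
assert (Hm : 0 < m) by lra.
assert (p * (m ^ 2 - w) <= p * / 4) by (apply Rmult_le_compat_l; lra).
assert (Hpx : 0 <= p ^ 2 - x ^ 2) by nra.
assert (K2 : q * (p ^ 2 - x ^ 2) <= m * (p ^ 2 - x ^ 2)) by (apply Rmult_le_compat_r; lra).
assert (p * (m * p) <= p * (m * m)) by (apply Rmult_le_compat_l; nra).
assert (m * x ^ 2 <= m * / 4) by nra.
assert (x ^ 2 <= / 4) by (apply Rmult_le_reg_l with m; lra).
apply Rabs_le. nra.
Qed.

(** The limit configuration around the digit [R + 1]: [t'], [t0], [t] are the steps before, at and
    after it, the alternating blocks contribute [t' * d] and [t * d], and the two products belong to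
    opposite corners. For [t' = t = 0] one product equals the bound. For [t' > 0] the step [t0] is
    [1 - t'] or [-1 - t'], and each choice singles out a corner. *)
Lemma central_corner_le (b d : R) (t' t0 t : Z) : 0 < b <= 0.268 -> d * (1 + b) = b ->
  Z.Even t' -> Z.abs (t' + t0) = 1%Z -> Z.abs (t0 + t) = 1%Z -> (t' <> 0 \/ t = 0)%Z ->
  (1 - b - IZR t' * d) * (1 - d - d * (IZR t0 + IZR t * d)) <= (1 - b) * (1 - 2 * d) \/
  (1 - b - - IZR t' * d) * (1 - d - d * (- IZR t0 + - IZR t * d)) <= (1 - b) * (1 - 2 * d).
Proof.
intros Hb Hd.
assert (D0 : 0 < d) by nra. assert (D1 : d < b) by nra. assert (D2 : d <= 0.22) by nra.
assert (pos : forall t' t0 t : Z, Z.Even t' -> Z.abs (t' + t0) = 1%Z -> Z.abs (t0 + t) = 1%Z ->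
  (0 < t')%Z ->
  (1 - b - IZR t' * d) * (1 - d - d * (IZR t0 + IZR t * d)) <= (1 - b) * (1 - 2 * d) \/
  (1 - b - - IZR t' * d) * (1 - d - d * (- IZR t0 + - IZR t * d)) <= (1 - b) * (1 - 2 * d)).
{ clear t' t0 t. intros t' t0 t [w Hw] H1 H2 H3.
  assert (Ht' : (2 <= t')%Z) by lia.
  assert (Hx : 2 <= IZR t') by now apply (IZR_le 2).
  assert (t0 = 1 - t' \/ t0 = -1 - t')%Z as [E|E] by lia.
  - left. assert (Ht : (t' - 2 <= t <= t')%Z) by lia.
    destruct Ht as [Ht Ht2]. apply IZR_le in Ht. apply IZR_le in Ht2. rewrite minus_IZR in Ht.
    rewrite E, minus_IZR. set (T' := IZR t') in *. set (T := IZR t) in *. clearbody T T'.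
    set (x := T' * d). set (y := d * (1 - T' + T * d)).
    assert (Hx0 : 0 < x) by (unfold x; nra).
    assert (Td : 0 <= T * d <= T' * 0.22) by (split; [apply Rmult_le_pos|apply Rmult_le_compat]; lra).
    assert (Hxy : d <= x + y) by (unfold x, y; nra).
    assert (Hy : y <= 0) by (unfold y; nra).
    assert (x * y <= 0) by nra.
    assert ((1 - b) * d <= (1 - b) * (x + y)) by (apply Rmult_le_compat_l; lra).
    nra.
  - right. assert (Ht : (t <= t' + 2)%Z) by lia. apply IZR_le in Ht. rewrite plus_IZR in Ht.
    rewrite E, minus_IZR. set (T' := IZR t') in *. set (T := IZR t) in *. clearbody T T'.
    (* The bound minus the product is [d ^ 2 * F]; the second factor [d] comes out through
       [d - b = - (b * d)]. *)
    set (F := T' * (- b) - (1 - b) * T + T' * (T' + 1 - T * d)).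
    assert (HF : 0 <= F).
    { assert (A1 : d * (T' * (T' + 2)) <= 0.22 * (T' * (T' + 2))).
      { apply Rmult_le_compat_r; [nra|lra]. }
      assert (A2 : 0 <= (T' + 2 - T) * (1 - b + T' * d)) by (apply Rmult_le_pos; nra).
      unfold F. nra. }
    assert (0 <= d * d * F) by (apply Rmult_le_pos; nra).
    assert (EF : T' * (d - b) - (1 - b) * T * d + T' * d * (1 + T' - T * d) = d * F).
    { replace (d - b) with (- (b * d)) by lra. unfold F. ring. }
    assert (EG : (1 - b) * (1 - 2 * d)
      - (1 - b - - T' * d) * (1 - d - d * (- (-1 - T') + - T * d)) = d * (d * F)).
    { rewrite <- EF. ring. }
    lra. }
intros He H1 H2 H3.
destruct (Z.lt_trichotomy t' 0) as [Hn|[H0|Hp]]; [| |now apply pos].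
- destruct (pos (- t') (- t0) (- t))%Z as [H|H]; try lia.
  + destruct He as [w Hw]. exists (- w)%Z. lia.
  + right. rewrite !opp_IZR in H. exact H.
  + left. rewrite !opp_IZR, !Ropp_involutive in H. exact H.
- assert (t = 0)%Z by lia. subst t' t.
  assert (t0 = 1 \/ t0 = -1)%Z as [E|E] by lia; subst t0; [left|right]; apply Req_le; ring.
Qed.

(** The factors move by at most [2 * h] and [(M + 3) * h], and these changes are multiplied by
    quantities of modulus at most 2 and 4. This gives the slope [4 * M + 16], rounded up. *)
Lemma corner_perturb (b d h M P Q X Z t' t0 t : R) : 0 <= h <= 1 -> 0 <= d <= 1 -> 0 <= b <= 1 ->
  Rabs (P - b) <= h -> Rabs (Q - d) <= h -> Rabs (X - t' * d) <= h -> Rabs (Z - t * d) <= h ->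
  Rabs Z <= 1 -> Rabs t0 <= M -> Rabs (1 - P - X) <= 2 -> Rabs (1 - Q - Q * (t0 + Z)) <= 2 ->
  (1 - P - X) * (1 - Q - Q * (t0 + Z)) <=
    (1 - b - t' * d) * (1 - d - d * (t0 + t * d)) + (4 * M + 20) * h.
Proof.
intros Hh Hd Hb HP HQ HX HZ HZ1 Ht0 HA HB.
assert (HM : 0 <= M) by (apply Rle_trans with (2 := Ht0); apply Rabs_pos).
set (A := 1 - P - X) in *. set (B := 1 - Q - Q * (t0 + Z)) in *.
set (A0 := 1 - b - t' * d). set (B0 := 1 - d - d * (t0 + t * d)).
assert (EA : Rabs (A - A0) <= 2 * h).
{ unfold A, A0. replace (1 - P - X - (1 - b - t' * d)) with (- (P - b) + - (X - t' * d)) by ring.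
  apply Rle_trans with (1 := Rabs_triang _ _). rewrite !Rabs_Ropp. lra. }
assert (EB : Rabs (B - B0) <= (M + 3) * h).
{ unfold B, B0.
  replace (1 - Q - Q * (t0 + Z) - (1 - d - d * (t0 + t * d)))
    with (- ((Q - d) * (1 + t0 + Z)) + - (d * (Z - t * d))) by ring.
  apply Rle_trans with (1 := Rabs_triang _ _). rewrite !Rabs_Ropp, !Rabs_mult.
  rewrite (Rabs_pos_eq d); [|lra].
  assert (T1 : Rabs (1 + t0 + Z) <= M + 2).
  { apply Rle_trans with (1 := Rabs_triang _ _).
    assert (H := Rabs_triang 1 t0). rewrite Rabs_R1 in H. lra. }
  assert (T2 : Rabs (Q - d) * Rabs (1 + t0 + Z) <= h * (M + 2)).
  { apply Rmult_le_compat; auto; apply Rabs_pos. }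
  assert (T3 : d * Rabs (Z - t * d) <= 1 * h).
  { apply Rmult_le_compat; auto; try lra; apply Rabs_pos. }
  lra. }
assert (HA0 : Rabs A0 <= 4).
{ replace A0 with (A + - (A - A0)) by ring.
  apply Rle_trans with (1 := Rabs_triang _ _). rewrite Rabs_Ropp. lra. }
replace (A * B) with (A0 * B0 + ((A - A0) * B + A0 * (B - B0))) by ring.
apply Rplus_le_compat_l. apply Rle_trans with (1 := Rle_abs _).
apply Rle_trans with (1 := Rabs_triang _ _). rewrite !Rabs_mult.
assert (T4 : Rabs (A - A0) * Rabs B <= 2 * h * 2).
{ apply Rmult_le_compat; auto; apply Rabs_pos. }
assert (T5 : Rabs A0 * Rabs (B - B0) <= 4 * ((M + 3) * h)).
{ apply Rmult_le_compat; auto; apply Rabs_pos. }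
lra.
Qed.

(** For the lower bound, with [c = 4 * climit b]. One displacement has a sign that enlarges its
    factor and is dropped, leaving [1 - q]. The other is either damped by [b], with room to spare,
    or sits next to the digit [R + 1], where [p <= d]; equality holds at [X = p = d], [q = b]. *)
Lemma corner_ge (b d c p q X : R) : 0 < b <= 0.268 -> d * (1 + b) = b -> c * (1 + b - b ^ 2) = (1 - b) ^ 2 ->
  0 <= p <= b -> 0 <= q <= b -> X <= p -> (X <= p * b \/ p <= d) ->
  c * (1 - q * p) <= (1 - p - X) * (1 - q).
Proof.
intros Hb Hd Hc Hp Hq HX HXp.
assert (D0 : 0 < d) by nra. assert (D1 : d < b) by nra. assert (D2 : d <= 0.22) by nra.
assert (C0 : 0 < c) by (apply Rmult_lt_reg_r with (1 + b - b ^ 2); [|rewrite Hc]; nra).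
assert (C1 : c < 1) by (apply Rmult_lt_reg_r with (1 + b - b ^ 2); [|rewrite Hc]; nra).
destruct HXp as [H|H].
- assert (A1 : c * (1 - q * p) <= c).
  { assert (0 <= c * (q * p)) by (apply Rmult_le_pos; [lra|apply Rmult_le_pos; lra]). lra. }
  assert (A2 : c <= (1 - b - b ^ 2) * (1 - b)).
  { apply Rmult_le_reg_r with (1 + b - b ^ 2); [nra|]. rewrite Hc.
    assert (0 <= b * (1 - b) * (1 - 3 * b + b ^ 3)) by (apply Rmult_le_pos; nra).
    nra. }
  assert (A3 : (1 - b - b ^ 2) * (1 - b) <= (1 - p - X) * (1 - q)) by (apply Rmult_le_compat; nra).
  lra.
- (* [(1 - 2 p) (1 - q) - c (1 - q p)] is bilinear, decreasing in [p] and [q], zero at [(d, b)]. *)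
  assert (E : c * (1 - b * d) = (1 - 2 * d) * (1 - b)).
  { apply Rmult_eq_reg_r with (1 + b); [|lra].
    replace (c * (1 - b * d) * (1 + b)) with (c * ((1 + b) - b * (d * (1 + b)))) by ring.
    replace ((1 - 2 * d) * (1 - b) * (1 + b)) with (((1 + b) - 2 * (d * (1 + b))) * (1 - b)) by ring.
    rewrite Hd. lra. }
  assert (S1 : 0 <= (d - p) * (2 * (1 - q) - c * q)) by (apply Rmult_le_pos; nra).
  assert (S2 : 0 <= (b - q) * ((1 - 2 * d) - c * d)) by (apply Rmult_le_pos; nra).
  assert (S3 : (1 - 2 * p) * (1 - q) <= (1 - p - X) * (1 - q)) by (apply Rmult_le_compat_r; lra).
  lra.
Qed.

(** If [J = 1], the window forces [I <= -1]; [I = -1] is a corner, and lowering [I] does not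
    decrease the product as long as [V >= p]. For any other odd [J], already [p * U] has modulus at
    least [1 - b]. *)
Lemma window_product_pos (b c p q x y : R) (I J : Z) : 0 < b <= 0.268 -> 0 < p <= b -> 0 <= q <= b ->
  Rabs x <= q -> Rabs y <= p -> c <= 1 - b -> c <= (1 - q - x) * (1 - p - y) ->
  Z.Odd I -> Z.Odd J ->
  p <= p * IZR I + IZR J - y < 1 ->
  c <= Rabs ((x + IZR I + q * IZR J) * (p * IZR I + IZR J - y)).
Proof.
intros Hb Hp Hq Hx Hy Hc Hc3 [i HI] [j HJ] HV.
apply Rabs_le_between in Hx. apply Rabs_le_between in Hy.
set (V := p * IZR I + IZR J - y) in *.
assert (Hpq : 0 <= p * q <= 0.268 * 0.268) by (split; [nra|apply Rmult_le_compat; lra]).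
assert (Hpx : - (p * q) <= p * x <= p * q) by nra.
assert (Hbb : 2 * (p * q) <= b) by nra.
assert (HpU : p * (x + IZR I + q * IZR J) = p * x + V - IZR J * (1 - p * q) + y).
{ unfold V. ring. }
set (U := x + IZR I + q * IZR J) in *.
assert (HV1 : p <= V) by lra.
(* [|U V| = (V / p) |p U|] and [V >= p]. *)
assert (Hbig : forall w, 0 <= w -> w <= Rabs (p * U) -> w <= Rabs (U * V)).
{ intros w Hw0 Hw. rewrite Rabs_mult, (Rabs_pos_eq V); [|lra].
  rewrite Rabs_mult, (Rabs_pos_eq p) in Hw; [|lra].
  apply Rle_trans with (1 := Hw). rewrite Rmult_comm.
  apply Rmult_le_compat_l; [apply Rabs_pos|exact HV1]. }
assert (J <= -1 \/ J = 1 \/ 3 <= J)%Z as [H|[H|H]] by lia.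
- apply IZR_le in H.
  assert (Hj : 1 * (1 - p * q) <= - IZR J * (1 - p * q)) by (apply Rmult_le_compat_r; lra).
  apply Rle_trans with (1 := Hc). apply Hbig; [lra|]. apply Rle_trans with (2 := Rle_abs _). lra.
- assert (HI1 : (I <= -1)%Z).
  { assert (p * IZR I < p * 1) by (unfold V in HV; rewrite H in HV; lra).
    apply Rmult_lt_reg_l in H0; [|lra]. apply (lt_IZR I 1) in H0. lia. }
  apply IZR_le in HI1. clear j HJ. subst J. set (i' := - IZR I).
  assert (E : - (U * V) = (i' - q - x) * (1 - p * i' - y)) by (unfold U, V, i'; ring).
  assert (G : 0 <= (i' - 1) * (V - p * (1 - q - x))).
  { apply Rmult_le_pos; [unfold i'; lra|]. lra. }
  rewrite <- Rabs_Ropp. apply Rle_trans with (2 := Rle_abs _). rewrite E.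
  unfold V, i' in *. lra.
- apply IZR_le in H.
  assert (Hj : 3 * (1 - p * q) <= IZR J * (1 - p * q)) by (apply Rmult_le_compat_r; lra).
  apply Rle_trans with (1 := Hc). apply Hbig; [lra|]. rewrite <- Rabs_Ropp.
  apply Rle_trans with (2 := Rle_abs _). lra.
Qed.

Lemma window_product (b c p q x y : R) (I J : Z) : 0 < b <= 0.268 -> 0 < p <= b -> 0 <= q <= b ->
  Rabs x <= q -> Rabs y <= p -> c <= 1 - b ->
  c <= (1 - q - x) * (1 - p - y) -> c <= (1 - q + x) * (1 - p + y) ->
  Z.Odd I -> Z.Odd J ->
  p <= Rabs (p * IZR I + IZR J - y) < 1 ->
  c <= Rabs ((x + IZR I + q * IZR J) * (p * IZR I + IZR J - y)).
Proof.
intros Hb Hp Hq Hx Hy Hc H3 H1 HI HJ HV.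
destruct (Rle_or_lt 0 (p * IZR I + IZR J - y)) as [S|S].
- rewrite Rabs_pos_eq in HV; [|exact S]. now apply (window_product_pos b).
- rewrite Rabs_left in HV; [|exact S].
  replace ((x + IZR I + q * IZR J) * (p * IZR I + IZR J - y))
    with ((- x + IZR (- I) + q * IZR (- J)) * (p * IZR (- I) + IZR (- J) - - y))
    by (rewrite !opp_IZR; ring).
  apply (window_product_pos b); auto; rewrite ?Rabs_Ropp; auto.
  + replace ((1 - q - - x) * (1 - p - - y)) with ((1 - q + x) * (1 - p + y)) by ring. exact H1.
  + destruct HI as [i HI]. exists (- i - 1)%Z. lia.
  + destruct HJ as [i HJ]. exists (- i - 1)%Z. lia.
  + rewrite !opp_IZR. lra.
Qed.

(** * Rounding, and the arms of the fundamental domain *)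

Lemma ceilZ_bounds (x : R) : x <= IZR (ceilZ x) < x + 1.
Proof.
unfold ceilZ. rewrite opp_IZR. destruct (base_Int_part (- x)). lra.
Qed.

Lemma dnint_le (x : R) (m : Z) : dnint x <= Rabs (x - IZR m).
Proof.
unfold dnint, floorZ. destruct (base_Int_part x) as [H1 H2]. set (f := Int_part x) in *.
destruct (Z_le_gt_dec m f) as [H|H].
- apply IZR_le in H. rewrite Rabs_pos_eq; [|lra].
  apply Rle_trans with (1 := Rmin_l _ _). lra.
- assert (Hm : (f + 1 <= m)%Z) by lia. apply IZR_le in Hm. rewrite plus_IZR in Hm.
  rewrite Rabs_left1; [|lra]. apply Rle_trans with (1 := Rmin_r _ _). lra.
Qed.

Lemma dnint_attained (x : R) : exists m : Z, dnint x = Rabs (x - IZR m).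
Proof.
unfold dnint, floorZ. destruct (base_Int_part x) as [H1 H2]. set (f := Int_part x) in *.
destruct (Rle_dec (x - IZR f) (IZR f + 1 - x)) as [H|H].
- exists f. rewrite Rmin_left; [|lra]. rewrite Rabs_pos_eq; lra.
- exists (f + 1)%Z. rewrite Rmin_right; [|lra]. rewrite plus_IZR, Rabs_left1; lra.
Qed.


(* Excludes centres in the two arms of the L-shaped fundamental domain around the open box of [cell]. *)
Lemma arm_products (e z H K : R) : 0 <= z <= e -> e <= 0.268 -> -0.268 <= H <= 1 ->
  0.1 <= K -> K < Rabs (z * H) -> K < Rabs ((e - z) * (1 - H)) -> False.
Proof.
intros Hz He HH HK H1 H2.
assert (P : K * K < Rabs (z * H) * Rabs ((e - z) * (1 - H))).
{ apply Rmult_le_0_lt_compat; lra. }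
rewrite <- Rabs_mult in P.
replace (z * H * ((e - z) * (1 - H))) with (z * (e - z) * (H * (1 - H))) in P by ring.
rewrite Rabs_mult in P.
assert (A1 : Rabs (z * (e - z)) <= 0.018).
{ assert (0 <= (2 * z - e) ^ 2) by apply pow2_ge_0. rewrite Rabs_pos_eq; nra. }
assert (A2 : Rabs (H * (1 - H)) <= 0.35).
{ apply Rabs_le. assert (0 <= (2 * H - 1) ^ 2) by apply pow2_ge_0. split; nra. }
assert (Rabs (z * (e - z)) * Rabs (H * (1 - H)) <= 0.018 * 0.35).
{ apply Rmult_le_compat; auto; apply Rabs_pos. }
nra.
Qed.

Lemma round_shift (X : R) : exists i : Z, Rabs (X + IZR i) <= / 2.
Proof.
exists (- Int_part (X + / 2))%Z. rewrite opp_IZR.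
destruct (base_Int_part (X + / 2)). apply Rabs_le. lra.
Qed.

(** * Data of the expansion and of the extremal shift *)

(** [C(R)] with [delta] eliminated through [delta = b / (1 + b)]. *)
Definition climit (b : R) : R := (1 - b) ^ 2 / (4 * (1 + b - b ^ 2)).

Lemma climit_pos b : 0 < b <= 0.268 -> 0 < climit b.
Proof. intros H. apply Rdiv_lt_0_compat; nra. Qed.

Lemma wmin_climit b : 0 < b <= 0.268 -> wmin b = 4 * climit b * (1 - b ^ 2).
Proof. intros H. unfold wmin, climit. field. nra. Qed.

Definition dig (a : R) (k : nat) : R := IZR (ncf_digit a k).

(* [back a k] is the reversed expansion [0; a_k, ..., a_1]^-, i.e. q_(k-1) / q_k. *)
Fixpoint back (a : R) (k : nat) : R :=
  match k with
  | O => 0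
  | S k => / (dig a k - back a k)
  end.

Fixpoint qden (a : R) (k : nat) : R :=
  match k with
  | O => 1
  | S k => qden a k * (dig a k - back a k)
  end.

(* [qerr a k] is q_(k-1) a - p_(k-1), one index behind [qden a k], which is q_k. *)
Fixpoint qerr (a : R) (k : nat) : R :=
  match k with
  | O => 1
  | S k => qerr a k * ncf_state a k
  end.

(** The scaling by [qden] and [qerr] makes differences of points integer combinations of [(1, al)]
    and [(ab, 1)]. *)
Definition grid (a g : R) (k : nat) (u v : R) : Prop :=
  exists n m : Z, IZR n = qden a k * u /\ IZR n * a - IZR m - g = qerr a k * v.

Definition altsign (j : nat) : Z := if Nat.even j then 1%Z else (-1)%Z.

Lemma altsign_S j : altsign (S j) = (- altsign j)%Z.
Proof. unfold altsign. rewrite Nat.even_succ, <- Nat.negb_even. now destruct (Nat.even j). Qed.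

Lemma altsign_sqr j : IZR (altsign j) * IZR (altsign j) = 1.
Proof. unfold altsign. destruct (Nat.even j); lra. Qed.

Definition spike (l k : nat) : Z :=
  if Nat.eqb (k mod (l + 1)) 0 then altsign (k / (l + 1)) else 0%Z.

(* The initial value [-1] makes the next term vanish, so that the bound by [back] holds from then on. *)
Fixpoint spike_x (a : R) (l k : nat) : R :=
  match k with
  | O => -1
  | S k => back a (S k) * (IZR (spike l k) + spike_x a l k)
  end.

(* [a / (1 + qerr a (l + 1))] is the value for which the recursion is antiperiodic of period [l + 1]. *)
Fixpoint spike_y (a : R) (l k : nat) : R :=
  match k with
  | O => a / (1 + qerr a (l + 1))
  | S k => spike_y a l k / ncf_state a k - IZR (spike l k)
  end.

(** * Bounds for the forward and backward expansions *)

Section Chain.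
Context (RR : Z) (b a : R) (HRR : (4 <= RR)%Z) (Hbr : b * (IZR RR - b) = 1)
  (Hb : 0 < b <= 0.268) (Ha : 0 < a < 1)
  (Hdig : forall k, (RR <= ncf_digit a k <= RR + 1)%Z).

Local Notation al := (ncf_state a).
Local Notation ab := (back a).

Lemma dig_bounds k : IZR RR <= dig a k <= IZR RR + 1.
Proof.
unfold dig. destruct (Hdig k) as [H1 H2]. apply IZR_le in H1. apply IZR_le in H2.
rewrite plus_IZR in H2. lra.
Qed.

Lemma r_ge4 : 4 <= IZR RR.
Proof. now apply IZR_le. Qed.

Lemma state_range k : 0 < al k < 1.
Proof.
induction k as [|k IH]; [exact Ha|].
assert (H := ceilZ_bounds (/ al k)).
assert (H1 : 0 <= al (S k) < 1) by (cbn [ncf_state]; lra).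
assert (H2 : al (S k) <> 0).
(* By the convention [/ 0 = 0], a vanishing state would have the digit [ceilZ 0 < 1], which is below
   [RR]. *)
{ intros E. assert (D := dig_bounds (S k)). unfold dig, ncf_digit in D.
  rewrite E, Rinv_0 in D. assert (C := ceilZ_bounds 0). assert (R4 := r_ge4). lra. }
lra.
Qed.

Lemma state_step k : al k * (dig a k - al (S k)) = 1.
Proof.
assert (H := state_range k). cbn [ncf_state]. unfold dig, ncf_digit. field. lra.
Qed.

(** [b] is a fixed point of [x = / (RR - x)], and the excess over it shrinks by a factor [b] with
    each digit; hence the induction on [n] for all [k] at once. *)
Lemma state_le_pow n k : al k <= b + b ^ n.
Proof.
assert (Hr := r_ge4). revert k.
induction n as [|n IH]; intros k.
- assert (H := state_range k). simpl. lra.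
- assert (H := state_range k). assert (H' := state_range (S k)).
  assert (E := state_step k). assert (D := dig_bounds k). specialize (IH (S k)).
  assert (Hp : 0 < b ^ n) by (apply pow_lt; lra). simpl.
  assert (al k * (IZR RR - b - b ^ n) <= 1).
  { rewrite <- E. apply Rmult_le_compat_l; lra. }
  assert (al k - b <= al k * b * b ^ n).
  { assert (K : b * (al k * (IZR RR - b - b ^ n)) <= b * 1) by (apply Rmult_le_compat_l; lra).
    replace (b * (al k * (IZR RR - b - b ^ n)))
      with (al k * (b * (IZR RR - b)) - al k * b * b ^ n) in K by ring.
    rewrite Hbr in K. lra. }
  assert (0 <= b * b ^ n) by (apply Rmult_le_pos; lra).
  assert (al k * (b * b ^ n) <= 1 * (b * b ^ n)) by (apply Rmult_le_compat_r; lra).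
  lra.
Qed.

Lemma state_le k : al k <= b.
Proof.
apply Rnot_lt_le. intros H.
destruct (pow_lt_1_zero b) with (y := al k - b) as [n Hn]; [rewrite Rabs_pos_eq; lra|lra|].
specialize (Hn n (Nat.le_refl n)). assert (E := state_le_pow n k).
rewrite Rabs_pos_eq in Hn; [lra|]. apply pow_le; lra.
Qed.

Lemma back_bounds k : 0 <= ab k <= b.
Proof.
assert (Hr := r_ge4).
induction k as [|k IH]; simpl; [lra|].
assert (D := dig_bounds k).
assert (H : 0 < IZR RR - b) by nra.
split; [left; apply Rinv_0_lt_compat; lra|].
apply Rmult_le_reg_r with (dig a k - ab k); [lra|]. rewrite Rinv_l; nra.
Qed.

Lemma dig_sub_back_gt k : 3 < dig a k - ab k.
Proof. assert (H := back_bounds k). assert (D := dig_bounds k). assert (Hr := r_ge4). lra. Qed.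

Lemma back_step k : ab (S k) * (dig a k - ab k) = 1.
Proof. assert (H := dig_sub_back_gt k). simpl. field. lra. Qed.

Lemma back_pos k : 0 < ab (S k).
Proof. assert (H := dig_sub_back_gt k). simpl. apply Rinv_0_lt_compat. lra. Qed.

Lemma qden_ge k : 3 ^ k <= qden a k.
Proof.
induction k as [|k IH]; simpl; [lra|].
assert (H := dig_sub_back_gt k). assert (0 < 3 ^ k) by (apply pow_lt; lra). nra.
Qed.

Lemma qden_pos k : 0 < qden a k.
Proof. apply Rlt_le_trans with (2 := qden_ge k). apply pow_lt. lra. Qed.

Lemma qerr_pos k : 0 < qerr a k.
Proof.
induction k as [|k IH]; simpl; [lra|]. assert (H := state_range k). nra.
Qed.

Lemma qerr_le k : qerr a k <= b ^ k.
Proof.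
induction k as [|k IH]; simpl; [lra|].
assert (H := state_range k). assert (H1 := state_le k). assert (H2 := qerr_pos k).
rewrite (Rmult_comm b). apply Rmult_le_compat; lra.
Qed.

Lemma qerr_anti k k' : (k <= k')%nat -> qerr a k' <= qerr a k.
Proof.
induction 1 as [|k' _ IH]; [lra|]. simpl.
assert (H := state_range k'). assert (H' := qerr_pos k'). nra.
Qed.

Lemma qden_step k : qden a (S k) * ab (S k) = qden a k.
Proof.
assert (H := back_step k). rewrite Rmult_comm in H. simpl qden.
now rewrite Rmult_assoc, H, Rmult_1_r.
Qed.

(** The lattice has covolume 1, while [(1, al)] and [(ab, 1)] span area [1 - al * ab]. Consequently
    [n * (n * a - m - g)] is [u * v / (1 - al * ab)] in grid coordinates. *)
Lemma qden_mul_qerr k : qden a k * qerr a k * (1 - al k * ab k) = 1.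
Proof.
induction k as [|k IH]; [simpl; ring|].
assert (E1 := state_step k). assert (E2 := back_step k).
rewrite <- (qden_step k) in IH. simpl qerr. apply eq_trans with (2 := IH).
replace (1 - al k * ab k) with (al k * (dig a k - ab k - al (S k))) by lra.
set (q := qden a (S k)). set (e := qerr a k). set (w := ab (S k)) in *.
replace (q * w * e * (al k * (dig a k - ab k - al (S k))))
  with (q * e * al k * (w * (dig a k - ab k) - w * al (S k))) by ring.
rewrite E2. ring.
Qed.

(** * Lattice and shifted lattice in the coordinates of a stage *)

Lemma lattice_coords k (n m : Z) :
  exists i j : Z, IZR n = qden a k * (IZR i + ab k * IZR j) /\
    IZR n * a - IZR m = qerr a k * (al k * IZR i + IZR j).
Proof.
induction k as [|k [i [j [H1 H2]]]].
- exists n, (- m)%Z. rewrite opp_IZR. simpl. split; ring.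
(* The change of basis is unimodular; its inverse is used in [coords_lattice]. *)
- exists (- j)%Z, (i + ncf_digit a k * j)%Z.
  rewrite opp_IZR, plus_IZR, mult_IZR. fold (dig a k).
  assert (E1 := state_step k). assert (E2 := back_step k). split.
  + rewrite H1, <- (qden_step k).
    transitivity (qden a (S k) * (ab (S k) * IZR i + ab (S k) * ab k * IZR j)); [ring|].
    replace (ab (S k) * ab k) with (ab (S k) * dig a k - 1) by lra. ring.
  + rewrite H2. simpl qerr. transitivity (qerr a k * (al k * IZR i + 1 * IZR j)); [ring|].
    rewrite <- E1. ring.
Qed.

Lemma coords_lattice k (i j : Z) :
  exists n m : Z, IZR n = qden a k * (IZR i + ab k * IZR j) /\
    IZR n * a - IZR m = qerr a k * (al k * IZR i + IZR j).
Proof.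
revert i j. induction k as [|k IH]; intros i j.
- exists i, (- j)%Z. rewrite opp_IZR. simpl. split; ring.
- destruct (IH (j + ncf_digit a k * i)%Z (- i)%Z) as [n [m [H1 H2]]].
  exists n, m. rewrite opp_IZR, plus_IZR, mult_IZR in H1, H2. fold (dig a k) in H1, H2.
  assert (E1 := state_step k). assert (E2 := back_step k). split.
  + rewrite H1, <- (qden_step k).
    transitivity (qden a (S k) * (ab (S k) * (dig a k - ab k) * IZR i + ab (S k) * IZR j)); [ring|].
    rewrite E2. ring.
  + rewrite H2. simpl qerr. transitivity (qerr a k * (al k * IZR j + (al k * dig a k - 1) * IZR i)); [ring|].
    rewrite <- E1. ring.
Qed.

Local Notation dl := (b / (1 + b)).

(** Two roles of [delta]: it is the alternating sum [b - b ^ 2 + b ^ 3 - ...] to which the steps of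
    a block add up, and the value of the expansion with digit [RR + 1] followed by [RR] forever. *)
Lemma delta_fix : dl = b * (1 - dl) /\ 0 < dl < b /\ dl * (IZR RR + 1 - b) = 1.
Proof.
assert (E : dl * (1 + b) = b) by (field; lra).
set (d := dl) in *. clearbody d.
assert (0 < d) by nra.
split; [lra|]. split; [nra|].
apply Rmult_eq_reg_l with b; [|lra].
replace (b * (d * (IZR RR + 1 - b))) with (d * (b * (IZR RR - b)) + d * b) by ring.
rewrite Hbr. lra.
Qed.

Context (g : R).

Lemma grid_translate k u v (i j : Z) : grid a g k u v ->
  grid a g k (u + IZR i + ab k * IZR j) (v + al k * IZR i + IZR j).
Proof.
intros [n [m [H1 H2]]]. destruct (coords_lattice k i j) as [n' [m' [H3 H4]]].
exists (n + n')%Z, (m + m')%Z. rewrite !plus_IZR. split; [rewrite H1, H3; ring|].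
transitivity (IZR n * a - IZR m - g + (IZR n' * a - IZR m')); [ring|].
rewrite H2, H4. ring.
Qed.

Lemma grid_difference k u v u' v' : grid a g k u v -> grid a g k u' v' ->
  exists i j : Z, u' - u = IZR i + ab k * IZR j /\ v' - v = al k * IZR i + IZR j.
Proof.
intros [n [m [H1 H2]]] [n' [m' [H3 H4]]].
destruct (lattice_coords k (n' - n) (m' - m)) as [i [j [H5 H6]]].
assert (HQ := qden_pos k). assert (HE := qerr_pos k).
exists i, j. rewrite minus_IZR in H5, H6. rewrite minus_IZR in H6. split.
- apply Rmult_eq_reg_l with (qden a k); [|lra]. rewrite <- H5, H1, H3. ring.
- apply Rmult_eq_reg_l with (qerr a k); [|lra]. rewrite <- H6.
  rewrite Rmult_minus_distr_l, <- H2, <- H4. ring.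
Qed.

Lemma grid_shift k u v : grid a g (S k) u v ->
  grid a g k ((dig a k - ab k) * u) (al k * v).
Proof.
intros [n [m [H1 H2]]]. exists n, m. simpl in H1, H2. split; [rewrite H1|rewrite H2]; ring.
Qed.

Lemma grid_inhabited k : exists u v, grid a g k u v.
Proof.
exists 0, (- g / qerr a k), 0%Z, 0%Z. assert (H := qerr_pos k). split; [ring|field; lra].
Qed.

(** * Cells, assuming that all late products exceed [Cc] *)

Section Cells.
Context (Cc : R) (k1 : nat) (HCc : climit b <= Cc) (Hk1 : (1 <= k1)%nat)
  (Hbig : forall k u v, (k1 <= k)%nat -> grid a g k u v -> Rabs v <= 3 ->
     Cc * (1 - ncf_state a k * back a k) < Rabs (u * v)).

(* Twice the centre of the parallelogram is [(x, - y)]; its edges are the basis vectors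
   [(1, al k)] and [(ab k, 1)] of the lattice at stage [k]. *)
Definition cell (k : nat) (x y : R) : Prop :=
  Rabs x < 1 - ab k /\ Rabs y < 1 - al k /\
  grid a g k ((x - 1 - ab k) / 2) ((- y - 1 - al k) / 2).

Lemma wmin_le_bound k : wmin b <= 4 * Cc * (1 - al k * ab k).
Proof.
assert (H1 := state_le k).
assert (H2 := state_range k).
assert (H3 := back_bounds k).
assert (H4 := climit_pos b Hb).
rewrite wmin_climit; [|exact Hb].
apply Rmult_le_compat; [lra| nra |lra|].
assert (al k * ab k <= b * b) by (apply Rmult_le_compat; lra). lra.
Qed.

(** Adding either basis vector to the given vertex yields two opposite vertices, whose coordinates
    have opposite signs. *)
Lemma cell_corners k x y : (k1 <= k)%nat -> cell k x y ->
  4 * Cc * (1 - al k * ab k) < (1 - ab k - x) * (1 - al k - y) /\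
  4 * Cc * (1 - al k * ab k) < (1 - ab k + x) * (1 - al k + y).
Proof.
intros Hk [Hx [Hy G]]. apply Rabs_def2 in Hx. apply Rabs_def2 in Hy.
assert (H2 := state_range k).
assert (H3 := back_bounds k).
assert (G1 := grid_translate k _ _ 1 0 G).
assert (G2 := grid_translate k _ _ 0 1 G).
apply Hbig in G1; [|exact Hk|apply Rabs_le; lra].
apply Hbig in G2; [|exact Hk|apply Rabs_le; lra].
set (p := al k) in *. set (q := ab k) in *.
split.
- replace (((x - 1 - q) / 2 + 0 + q * 1) * ((- y - 1 - p) / 2 + p * 0 + 1))
    with (- ((1 - q - x) * (1 - p - y) / 4)) in G2 by field.
  rewrite Rabs_Ropp, Rabs_pos_eq in G2; [lra|].
  assert (0 <= (1 - q - x) * (1 - p - y)) by (apply Rmult_le_pos; lra). lra.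
- replace (((x - 1 - q) / 2 + 1 + q * 0) * ((- y - 1 - p) / 2 + p * 1 + 0))
    with (- ((1 - q + x) * (1 - p + y) / 4)) in G1 by field.
  rewrite Rabs_Ropp, Rabs_pos_eq in G1; [lra|].
  assert (0 <= (1 - q + x) * (1 - p + y)) by (apply Rmult_le_pos; lra). lra.
Qed.

(** Rounding the coordinates of the centre in the lattice basis gives [|x| <= 1 + ab] and
    [|y| <= 1 + al]. If [x] or [y] lay outside the open box, two vertices on the same side would
    contradict [arm_products]. *)
Lemma cell_exists k : (k1 <= k)%nat -> exists x y, cell k x y.
Proof.
intros Hk.
assert (H1 := state_le k).
assert (H2 := state_range k).
assert (H3 := back_bounds k).
assert (HW := wmin_le_bound k). assert (HW2 := wmin_ge b Hb).
destruct (grid_inhabited k) as [u [v G]].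
set (u' := u + (1 + ab k) / 2). set (v' := v + (1 + al k) / 2).
set (D := 1 - al k * ab k).
assert (HD : 0 < D) by (unfold D; nra).
destruct (round_shift ((u' - ab k * v') / D)) as [i Hi].
destruct (round_shift ((v' - al k * u') / D)) as [j Hj].
set (X := (u' - ab k * v') / D + IZR i) in *.
set (Y := (v' - al k * u') / D + IZR j) in *.
assert (G0 := grid_translate k _ _ i j G).
set (x := 2 * (X + ab k * Y)). set (y := - (2 * (al k * X + Y))).
assert (Gxy : grid a g k ((x - 1 - ab k) / 2) ((- y - 1 - al k) / 2)).
{ replace ((x - 1 - ab k) / 2) with (u + IZR i + ab k * IZR j).
  replace ((- y - 1 - al k) / 2) with (v + al k * IZR i + IZR j); [exact G0|].
  - unfold y, X, Y, u', v', D in *. field. lra.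
  - unfold x, X, Y, u', v', D in *. field. lra. }
apply Rabs_le_between in Hi. apply Rabs_le_between in Hj.
assert (Hx : - (1 + ab k) <= x <= 1 + ab k) by (unfold x; split; nra).
assert (Hy : - (1 + al k) <= y <= 1 + al k) by (unfold y; split; nra).
clearbody x y. clear X Y Hi Hj G0 G HD.
assert (Hb1 := Hb).
(* [0.1] is below [wmin b / 4], because [1 - 3 * b + 3 * b ^ 2 > 0.4] on the range of [b]. *)
assert (V : forall i j : Z, Rabs (((- y - 1 - al k) / 2 + al k * IZR i + IZR j)) <= 3 ->
  0.1 < Rabs (((x - 1 - ab k) / 2 + IZR i + ab k * IZR j) *
              ((- y - 1 - al k) / 2 + al k * IZR i + IZR j))).
{ intros i' j' Hv. apply Rle_lt_trans with (Cc * (1 - al k * ab k)); [nra|].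
  apply Hbig; auto. now apply grid_translate. }
assert (V00 := V 0%Z 0%Z). assert (V10 := V 1%Z 0%Z).
assert (V01 := V 0%Z 1%Z). assert (V11 := V 1%Z 1%Z). clear V.
set (p := al k) in *. set (q := ab k) in *.
specialize (V00 ltac:(apply Rabs_le; lra)). specialize (V10 ltac:(apply Rabs_le; lra)).
specialize (V01 ltac:(apply Rabs_le; lra)). specialize (V11 ltac:(apply Rabs_le; lra)).
exists x, y. unfold cell. fold p q.
split; [|split; [|exact Gxy]]; apply Rnot_le_lt; intros HH.
- destruct (Rle_or_lt 0 x) as [S|S].
  + rewrite Rabs_pos_eq in HH; [|lra]. exfalso.
    apply (arm_products q ((x - (1 - q)) / 2) ((1 - p - y) / 2) 0.1); try lra.
    * eapply Rlt_le_trans; [exact V01|]. apply Req_le. f_equal. field.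
    * eapply Rlt_le_trans; [exact V00|]. apply Req_le. f_equal. field.
  + rewrite Rabs_left in HH; [|lra]. exfalso.
    apply (arm_products q ((- x - (1 - q)) / 2) ((1 - p + y) / 2) 0.1); try lra.
    * eapply Rlt_le_trans; [exact V10|]. apply Req_le. f_equal. field.
    * eapply Rlt_le_trans; [exact V11|]. apply Req_le. f_equal. field.
- destruct (Rle_or_lt 0 y) as [S|S].
  + rewrite Rabs_pos_eq in HH; [|lra]. exfalso.
    apply (arm_products p ((y - (1 - p)) / 2) ((1 - q - x) / 2) 0.1); try lra.
    * eapply Rlt_le_trans; [exact V01|]. apply Req_le. f_equal. field.
    * eapply Rlt_le_trans; [exact V11|]. apply Req_le. f_equal. field.
  + rewrite Rabs_left in HH; [|lra]. exfalso.
    apply (arm_products p ((- y - (1 - p)) / 2) ((1 - q + x) / 2) 0.1); try lra.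
    * eapply Rlt_le_trans; [exact V10|]. apply Req_le. f_equal. field.
    * eapply Rlt_le_trans; [exact V00|]. apply Req_le. f_equal. field.
Qed.

Definition link (k : nat) (t : Z) (x y x' y' : R) : Prop :=
  x' = ab (S k) * (IZR t + x) /\ y = al k * (IZR t + y') /\ Z.Even (t - ncf_digit a k).

(** In the coordinates of stage [k], twice the displacement of the centre is [t] times [(1, al)]
    plus [2 * m] times [(ab, 1)], with [t] of the parity of the digit. The two boxes leave room only
    for [m = 0]. *)
Lemma cell_link k x y x' y' : cell k x y -> cell (S k) x' y' ->
  exists t, link k t x y x' y'.
Proof.
intros [Hx [Hy G]] [Hx' [Hy' G']].
apply grid_shift in G'.
destruct (grid_difference k _ _ _ _ G G') as [i [j [E1 E2]]].
assert (H1 := state_le k).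
assert (H2 := state_range k).
assert (H3 := back_bounds k).
assert (H4 := dig_sub_back_gt k).
assert (H5 := state_step k).
assert (H6 := back_step k).
assert (H7 := back_pos k).
set (t := (ncf_digit a k + 2 * i)%Z).
set (m := (j - 1)%Z).
assert (Et : IZR t = dig a k + 2 * IZR i) by (unfold t; now rewrite plus_IZR, mult_IZR).
assert (Em : IZR j = IZR m + 1) by (unfold m; rewrite minus_IZR; ring).
set (A := dig a k) in *. set (p := al k) in *. set (q := ab k) in *.
assert (F1 : (A - q) * x' - x = IZR t + 2 * q * IZR m) by (rewrite Et; nra).
assert (F2 : y - p * y' = p * IZR t + 2 * IZR m).
{ rewrite Et. replace (IZR m) with (IZR j - 1) by lra.
  set (p' := al (S k)) in *.
  replace (p * (A + 2 * IZR i)) with (p * (A - p') + p * p' + 2 * p * IZR i) by ring.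
  rewrite H5. nra. }
assert (Hm : m = 0%Z).
{ assert (B1 : Rabs (IZR t + 2 * q * IZR m) < A - 2 * q).
  { rewrite <- F1. unfold Rminus at 1. apply Rle_lt_trans with (1 := Rabs_triang _ _).
    rewrite Rabs_Ropp, Rabs_mult, (Rabs_pos_eq (A - q)); [|lra].
    assert ((A - q) * Rabs x' < (A - q) * (1 - ab (S k))) by (apply Rmult_lt_compat_l; lra).
    lra. }
  assert (B2 : Rabs (p * IZR t + 2 * IZR m) < 2 - A * p).
  { rewrite <- F2. unfold Rminus at 1. apply Rle_lt_trans with (1 := Rabs_triang _ _).
    rewrite Rabs_Ropp, Rabs_mult, (Rabs_pos_eq p); [|lra].
    assert (p * Rabs y' < p * (1 - al (S k))) by (apply Rmult_lt_compat_l; lra).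
    lra. }
  (* Subtracting [p] times the first displacement from the second eliminates [t], and the bounds add
     up to exactly [2 * (1 - p * q)]. *)
  assert (B3 : Rabs (2 * (1 - p * q) * IZR m) < 2 * (1 - p * q)).
  { replace (2 * (1 - p * q) * IZR m)
      with (p * IZR t + 2 * IZR m + - (p * (IZR t + 2 * q * IZR m))) by ring.
    apply Rle_lt_trans with (1 := Rabs_triang _ _).
    rewrite Rabs_Ropp, Rabs_mult, (Rabs_pos_eq p); [|lra].
    assert (p * Rabs (IZR t + 2 * q * IZR m) < p * (A - 2 * q)) by (apply Rmult_lt_compat_l; lra).
    lra. }
  assert (Hpq : p * q <= 1 * 0.268) by (apply Rmult_le_compat; lra).
  rewrite Rabs_mult, (Rabs_pos_eq (2 * _)) in B3; [|lra].
  assert (B4 : Rabs (IZR m) < 1).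
  { apply Rmult_lt_reg_l with (2 * (1 - p * q)); lra. }
  apply Rabs_def2 in B4. destruct B4 as [B4 B5].
  apply lt_IZR in B4. apply (lt_IZR (-1)) in B5. lia. }
rewrite Hm in F1, F2. exists t. unfold link. fold p A. split; [|split].
- apply Rmult_eq_reg_l with (A - q); [|lra].
  replace ((A - q) * (ab (S k) * (IZR t + x))) with (ab (S k) * (A - q) * (IZR t + x)) by ring.
  rewrite H6. lra.
- lra.
- exists i. unfold t. ring.
Qed.

Lemma state_ge k : / dig a k <= al k.
Proof.
assert (D := dig_bounds k). assert (Hr := r_ge4).
assert (H := state_step k).
assert (H2 := state_range k).
assert (H3 := state_range (S k)).
apply Rmult_le_reg_r with (dig a k); [lra|]. rewrite Rinv_l; nra.
Qed.

Lemma back_ge k : / dig a k <= ab (S k).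
Proof.
assert (D := dig_bounds k). assert (Hr := r_ge4).
assert (H := back_bounds k).
simpl. apply Rinv_le_contravar; lra.
Qed.

Lemma inv_dig_ge k : / (IZR RR + 1) <= / dig a k.
Proof.
assert (D := dig_bounds k). assert (Hr := r_ge4).
apply Rinv_le_contravar; lra.
Qed.

Lemma cell_half k x y : (k1 <= k)%nat -> cell k x y -> Rabs x <= / 2 /\ Rabs y <= / 2.
Proof.
intros Hk Hc. destruct (cell_corners k x y Hk Hc) as [C1 C2].
destruct Hc as [Hx [Hy _]]. assert (HW := wmin_le_bound k).
assert (P := Rabs_pos x). assert (P' := Rabs_pos y).
assert (H1 := state_ge k). assert (H2 := inv_dig_ge k).
destruct k as [|k]; [lia|].
assert (H3 := back_ge k). assert (H4 := inv_dig_ge k).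
split.
- apply (half_box (IZR RR) b (1 - ab (S k)) (1 - al (S k)) x y); auto; lra.
- apply (half_box (IZR RR) b (1 - al (S k)) (1 - ab (S k)) y x); auto; lra.
Qed.

(** [al >= / (RR + 1)] and [|y| <= / 2] give [|t| <= RR / 2 + 1]; the cruder bound suffices for
    error constants uniform in the stage. *)
Lemma link_bound k t x y x' y' : (k1 <= k)%nat ->
  cell k x y -> cell (S k) x' y' -> link k t x y x' y' -> Rabs (IZR t) <= IZR RR.
Proof.
intros Hk C1 C2 [_ [E _]].
destruct (cell_half k x y Hk C1) as [_ B1].
destruct (cell_half (S k) x' y') as [_ B2]; [lia|exact C2|].
assert (H1 := state_ge k). assert (H2 := inv_dig_ge k). assert (Hr := r_ge4).
assert (H2' := Rinv_0_lt_compat (IZR RR + 1) ltac:(lra)).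
assert (H3 : / (IZR RR + 1) * Rabs (IZR t + y') <= / 2).
{ apply Rle_trans with (al k * Rabs (IZR t + y')).
  - apply Rmult_le_compat_r; [apply Rabs_pos|lra].
  - rewrite <- (Rabs_pos_eq (al k)) by lra. rewrite <- Rabs_mult, <- E. exact B1. }
assert (H4 : Rabs (IZR t + y') <= (IZR RR + 1) / 2).
{ apply Rmult_le_reg_l with (/ (IZR RR + 1)); [lra|]. apply Rle_trans with (1 := H3).
  apply Req_le. field. lra. }
replace (IZR t) with (IZR t + y' + - y') by ring.
apply Rle_trans with (1 := Rabs_triang _ _). rewrite Rabs_Ropp. lra.
Qed.

(** Otherwise, since [x] and [y2] are at most [/ 2] in modulus, the sum
    [(1 + t + x) + (1 + t' + y2)], or the same with the signs of [t + x] and [t' + y2] reversed, is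
    at least [s], and [corner_product_le] contradicts [cell_corners]. *)
Lemma corner_sum_lt k s gg t t' x y x1 y1 x2 y2 : (k1 <= k)%nat ->
  cell k x y -> cell (S k) x1 y1 -> cell (S (S k)) x2 y2 ->
  link k t x y x1 y1 -> link (S k) t' x1 y1 x2 y2 ->
  0 < gg -> 3 <= s -> gg <= ab (S k) -> gg <= al (S k) -> b - gg <= s * b * gg ->
  (1 - s * gg / 2) ^ 2 <= wmin b -> Rabs (IZR t + IZR t') < s - 1.
Proof.
intros Hk C0 C1 C2 [L1 [_ _]] [_ [L2 _]] Hg Hs G1 G2 Hbg Hw.
destruct (cell_half k x y Hk C0) as [B0 _].
destruct (cell_half (S (S k)) x2 y2) as [_ B2]; [lia|exact C2|].
assert (HS : (k1 <= S k)%nat) by lia.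
destruct (cell_corners (S k) x1 y1 HS C1) as [K1 K2].
destruct C1 as [Bx [By _]].
assert (HW := wmin_le_bound (S k)).
assert (H1 := state_le (S k)).
assert (H3 := back_bounds (S k)).
apply Rabs_le_between in B0. apply Rabs_le_between in B2.
apply Rabs_def2 in Bx. apply Rabs_def2 in By.
rewrite L1, L2 in *.
apply Rnot_le_lt. intros Hbad.
destruct (Rle_or_lt 0 (IZR t + IZR t')) as [Sg|Sg].
- rewrite Rabs_pos_eq in Hbad; [|exact Sg].
  assert (Q := corner_product_le b gg s (ab (S k)) (al (S k)) (IZR t + x) (IZR t' + y2)).
  specialize (Q Hg Hs ltac:(lra) ltac:(lra) Hbg ltac:(lra) ltac:(lra) ltac:(lra)). lra.
- rewrite Rabs_left in Hbad; [|exact Sg].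
  assert (Q := corner_product_le b gg s (ab (S k)) (al (S k)) (- (IZR t + x)) (- (IZR t' + y2))).
  specialize (Q Hg Hs ltac:(lra) ltac:(lra) Hbg ltac:(lra) ltac:(lra) ltac:(lra)). lra.
Qed.

Lemma link_sum_even k t t' x y x1 y1 x2 y2 : Z.Even RR -> (k1 <= k)%nat ->
  cell k x y -> cell (S k) x1 y1 -> cell (S (S k)) x2 y2 ->
  link k t x y x1 y1 -> link (S k) t' x1 y1 x2 y2 ->
  ncf_digit a k = RR -> ncf_digit a (S k) = RR -> (t' = - t)%Z.
Proof.
intros HE Hk C0 C1 C2 L1 L2 D1 D2.
destruct (even_corner_lt (IZR RR) b Hbr Hb) as [W1 W2].
assert (Hr := r_ge4).
assert (H := corner_sum_lt k 3 (/ IZR RR) t t' x y x1 y1 x2 y2 Hk C0 C1 C2 L1 L2).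
assert (G1 := back_ge k). assert (G2 := state_ge (S k)).
unfold dig in G1, G2. rewrite D1 in G1. rewrite D2 in G2.
specialize (H ltac:(apply Rinv_0_lt_compat; lra) ltac:(lra) G1 G2 W1 W2).
rewrite <- plus_IZR, <- abs_IZR in H.
(* Two even digits make [t + t'] even, so only 0 remains; in [link_sum_odd] it is odd and of modulus
   below 3. *)
assert (H' : IZR (Z.abs (t + t')) < 2) by lra. apply lt_IZR in H'.
destruct L1 as [_ [_ [u Hu]]], L2 as [_ [_ [v Hv]]], HE as [w Hw]. lia.
Qed.

Lemma link_sum_odd k t t' x y x1 y1 x2 y2 : Z.Even RR -> (k1 <= k)%nat ->
  cell k x y -> cell (S k) x1 y1 -> cell (S (S k)) x2 y2 ->
  link k t x y x1 y1 -> link (S k) t' x1 y1 x2 y2 ->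
  (ncf_digit a k + ncf_digit a (S k) = 2 * RR + 1)%Z -> (Z.abs (t + t') = 1)%Z.
Proof.
intros HE Hk C0 C1 C2 L1 L2 D.
destruct (odd_corner_lt (IZR RR) b Hbr Hb) as [W1 W2].
assert (Hr := r_ge4).
assert (H := corner_sum_lt k 4 (/ (IZR RR + 1)) t t' x y x1 y1 x2 y2 Hk C0 C1 C2 L1 L2).
assert (G1 := back_ge k). assert (G2 := state_ge (S k)).
assert (I1 := inv_dig_ge k). assert (I2 := inv_dig_ge (S k)).
specialize (H ltac:(apply Rinv_0_lt_compat; lra) ltac:(lra) ltac:(lra) ltac:(lra) W1 W2).
rewrite <- plus_IZR, <- abs_IZR in H.
assert (H' : IZR (Z.abs (t + t')) < 3) by lra. apply lt_IZR in H'.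
destruct L1 as [_ [_ [u Hu]]], L2 as [_ [_ [v Hv]]], HE as [w Hw]. lia.
Qed.

(** * Exponential approach to the limit along a block of digits [RR] *)

Lemma state_gap n k : (forall i, (i < n)%nat -> ncf_digit a (k + i) = RR) ->
  Rabs (al k - b) <= (/ 4) ^ n.
Proof.
revert k. induction n as [|n IH]; intros k Hd.
- assert (H := state_range k). apply Rabs_le. simpl. lra.
- assert (H := state_range k). assert (H1 := state_le k). assert (E := state_step k).
  assert (D := Hd 0%nat ltac:(lia)). rewrite Nat.add_0_r in D.
  unfold dig in E. rewrite D in E.
  assert (Q : al k - b = (al k * b) * (al (S k) - b)).
  { transitivity (al k * (b * (IZR RR - b)) - b * (al k * (IZR RR - al (S k)))); [rewrite Hbr, E|]; ring. }
  rewrite Q, Rabs_mult, Rabs_pos_eq; [|nra]. cbn [pow].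
  apply Rmult_le_compat; [nra|apply Rabs_pos|nra|].
  apply IH. intros i Hi. replace (S k + i)%nat with (k + S i)%nat by lia. apply Hd. lia.
Qed.

Lemma back_gap n k : (forall i, (i < n)%nat -> ncf_digit a (k + i) = RR) ->
  Rabs (ab (k + n) - b) <= (/ 4) ^ n.
Proof.
induction n as [|n IH]; intros Hd.
- assert (H := back_bounds (k + 0)). apply Rabs_le. simpl. lra.
- replace (k + S n)%nat with (S (k + n)) by lia.
  assert (E := back_step (k + n)). assert (H := back_bounds (S (k + n))).
  unfold dig in E. rewrite (Hd n) in E; [|lia].
  assert (Q : ab (S (k + n)) - b = (ab (S (k + n)) * b) * (ab (k + n) - b)).
  { transitivity (ab (S (k + n)) * (b * (IZR RR - b)) - b * (ab (S (k + n)) * (IZR RR - ab (k + n))));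
      [rewrite Hbr, E|]; ring. }
  rewrite Q, Rabs_mult, Rabs_pos_eq; [|nra]. cbn [pow].
  apply Rmult_le_compat; [nra|apply Rabs_pos|nra|].
  apply IH. intros i Hi. apply Hd. lia.
Qed.

(** [t * dl] solves [e = b * (t - e)]. The error comes from [c - b], at most a quarter of the
    current scale, and from [z], damped by [c <= 0.268]; the constant [2 * RR + 4] is large enough
    for their sum to halve. *)
Lemma tail_step n c e z t : Rabs t <= IZR RR -> 0 <= c <= b ->
  Rabs (c - b) <= (/ 4) ^ S n -> Rabs (z - - t * dl) <= (2 * IZR RR + 4) / 2 ^ n ->
  e = c * (t + z) -> Rabs (e - t * dl) <= (2 * IZR RR + 4) / 2 ^ S n.
Proof.
intros Ht Hc Hcb Hz' He. destruct delta_fix as [F1 [F2 _]].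
assert (Hr := r_ge4).
set (d := dl) in *. clearbody d.
assert (F3 : t * d = t * (b * (1 - d))) by now rewrite <- F1.
replace (e - t * d) with ((c - b) * ((1 - d) * t) + c * (z - - t * d)) by (rewrite He; lra).
apply Rle_trans with (1 := Rabs_triang _ _). rewrite !Rabs_mult.
rewrite (Rabs_pos_eq (1 - d)), (Rabs_pos_eq c); [|lra|lra].
assert (P2 : 0 < / 2 ^ n) by (apply Rinv_0_lt_compat, pow_lt; lra).
assert (P4 : (/ 4) ^ n <= / 2 ^ n).
{ rewrite pow_inv. apply Rinv_le_contravar; [apply pow_lt; lra|]. apply pow_incr. lra. }
assert (P5 : 0 < (/ 4) ^ n) by (apply pow_lt; lra).
assert (P6 : 0 < 2 ^ n) by (apply pow_lt; lra).
simpl in Hcb. unfold Rdiv in *. set (w := / 2 ^ n) in *.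
replace (/ 2 ^ S n) with (/ 2 * w) by (unfold w; simpl; field; lra).
assert (B1 : (1 - d) * Rabs t <= 1 * IZR RR).
{ apply Rmult_le_compat; [lra|apply Rabs_pos|lra|lra]. }
assert (B2 : Rabs (c - b) * ((1 - d) * Rabs t) <= (/ 4 * w) * (1 * IZR RR)).
{ apply Rmult_le_compat; [apply Rabs_pos| |lra|lra].
  apply Rmult_le_pos; [lra|apply Rabs_pos]. }
assert (B3 : c * Rabs (z - - t * d) <= 0.268 * ((2 * IZR RR + 4) * w)).
{ apply Rmult_le_compat; [lra|apply Rabs_pos|lra|lra]. }
nra.
Qed.

Lemma trivial_tail z t : Rabs z <= / 2 -> Rabs t <= IZR RR ->
  Rabs (z - - t * dl) <= IZR RR + 2.
Proof.
intros Hz Ht. destruct delta_fix as [_ [F2 _]].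
replace (z - - t * dl) with (z + t * dl) by ring.
apply Rle_trans with (1 := Rabs_triang _ _). rewrite Rabs_mult, (Rabs_pos_eq dl); [|lra].
assert (Rabs t * dl <= IZR RR * 1) by (apply Rmult_le_compat; try lra; apply Rabs_pos).
lra.
Qed.

Lemma right_tail n k t x y x1 y1 : Z.Even RR -> (k1 <= k)%nat ->
  (forall i, (i < n)%nat -> ncf_digit a (k + i) = RR) ->
  cell k x y -> cell (S k) x1 y1 -> link k t x y x1 y1 ->
  Rabs (y - IZR t * dl) <= (2 * IZR RR + 4) / 2 ^ n.
Proof.
intros HE. revert k t x y x1 y1. induction n as [|n IH]; intros k t x y x1 y1 Hk Hd C0 C1 L.
- destruct (cell_half k x y Hk C0) as [_ B].
  assert (Bt := link_bound k t x y x1 y1 Hk C0 C1 L).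
  rewrite <- Rabs_Ropp in Bt.
  assert (H := trivial_tail y (- IZR t) B Bt). rewrite Ropp_involutive in H.
  assert (Hr := r_ge4). simpl. lra.
- assert (Bt := link_bound k t x y x1 y1 Hk C0 C1 L).
  assert (H1 := state_range k). assert (H2 := state_le k).
  apply tail_step with (c := al k) (z := y1); [exact Bt|lra|now apply state_gap| |now apply L].
  assert (Hk' : (k1 <= S k)%nat) by lia.
  (* When one digit [RR] is left, the next step may belong to [RR + 1], where no cancellation of
     steps is known; the crude bound is enough there. *)
  destruct n as [|n].
  { destruct (cell_half (S k) x1 y1 Hk' C1) as [_ B].
    assert (H := trivial_tail y1 (IZR t) B Bt). assert (Hr := r_ge4). simpl. lra. }
  destruct (cell_exists (S (S k)) ltac:(lia)) as [x2 [y2 C2]].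
  destruct (cell_link _ _ _ _ _ C1 C2) as [t' L'].
  assert (D0 := Hd 0%nat ltac:(lia)). rewrite Nat.add_0_r in D0.
  assert (D1 := Hd 1%nat ltac:(lia)). rewrite Nat.add_1_r in D1.
  assert (E := link_sum_even k t t' x y x1 y1 x2 y2 HE Hk C0 C1 C2 L L' D0 D1).
  rewrite <- opp_IZR, <- E.
  apply (IH (S k) t' x1 y1 x2 y2); auto.
  intros i Hi. replace (S k + i)%nat with (k + S i)%nat by lia. apply Hd. lia.
Qed.

Lemma left_tail n k t x y x1 y1 : Z.Even RR -> (k1 <= k)%nat ->
  (forall i, (i < n)%nat -> ncf_digit a (S k + i) = RR) ->
  cell (k + n) x y -> cell (S (k + n)) x1 y1 -> link (k + n) t x y x1 y1 ->
  Rabs (x1 - IZR t * dl) <= (2 * IZR RR + 4) / 2 ^ n.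
Proof.
intros HE Hk. revert t x y x1 y1. induction n as [|n IH]; intros t x y x1 y1 Hd C0 C1 L.
- destruct (cell_half (S (k + 0)) x1 y1) as [B _]; [lia|exact C1|].
  assert (Bt := link_bound (k + 0) t x y x1 y1 ltac:(lia) C0 C1 L).
  rewrite <- Rabs_Ropp in Bt.
  assert (H := trivial_tail x1 (- IZR t) B Bt). rewrite Ropp_involutive in H.
  assert (Hr := r_ge4). simpl. lra.
- assert (Bt := link_bound (k + S n) t x y x1 y1 ltac:(lia) C0 C1 L).
  assert (H1 := back_bounds (S (k + S n))).
  apply tail_step with (c := ab (S (k + S n))) (z := x); [exact Bt|lra| | |now apply L].
  { replace (S (k + S n)) with (S k + S n)%nat by lia. now apply back_gap. }
  destruct n as [|n].
  { destruct (cell_half (k + 1) x y) as [B _]; [lia|exact C0|].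
    assert (H := trivial_tail x (IZR t) B Bt). assert (Hr := r_ge4). simpl. lra. }
  assert (En : (k + S (S n) = S (k + S n))%nat) by lia.
  rewrite En in *.
  destruct (cell_exists (k + S n) ltac:(lia)) as [x0 [y0 C]].
  destruct (cell_link _ _ _ _ _ C C0) as [t' L'].
  assert (D0 := Hd n ltac:(lia)). replace (S k + n)%nat with (k + S n)%nat in D0 by lia.
  assert (D1 := Hd (S n) ltac:(lia)). replace (S k + S n)%nat with (S (k + S n))%nat in D1 by lia.
  assert (E := link_sum_even (k + S n) t' t x0 y0 x y x1 y1 HE ltac:(lia) C C0 C1 L' L D0 D1).
  replace (- IZR t) with (IZR t') by (rewrite E, opp_IZR; ring).
  apply (IH t' x0 y0 x y); auto.
Qed.

(** * Contradiction next to the digit [RR + 1] *)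

Lemma delta_climit : 4 * climit b * (1 - dl * b) = (1 - b) * (1 - 2 * dl).
Proof. unfold climit. field. split; nra. Qed.

Lemma delta_gap A p q h : 0 < p <= dl -> 0 <= q -> IZR A = IZR RR + 1 ->
  p * (IZR A - q) = 1 -> Rabs (q - b) <= h -> Rabs (p - dl) <= h.
Proof.
intros Hp Hq HA E Hqb. destruct delta_fix as [_ [F2 F3]]. rewrite HA in E.
set (d := dl) in *. clearbody d.
assert (Q : p - d = (p * d) * (q - b)).
{ transitivity (p * (d * (IZR RR + 1 - b)) - d * (p * (IZR RR + 1 - q))); [rewrite F3, E|]; ring. }
rewrite Q, Rabs_mult, Rabs_pos_eq; [|nra].
assert (p * d * Rabs (q - b) <= 1 * h).
{ apply Rmult_le_compat; auto; try nra. apply Rabs_pos. }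
lra.
Qed.

Lemma digit_parity_even k t x y x' y' : Z.Even RR -> ncf_digit a k = RR ->
  link k t x y x' y' -> Z.Even t.
Proof.
intros [w Hw] D [_ [_ [u Hu]]]. exists (u + w)%Z. lia.
Qed.

(** The blocks on both sides of the index [c] put the cell within [h] of a configuration of
    [central_corner_le]. The perturbation costs less than [3 * (Cc - climit b)], the surplus that
    the corners must have. *)
Lemma odd_digit_contradiction k n : Z.Even RR -> (k1 <= k)%nat -> (1 <= n)%nat ->
  (forall i, (i < n)%nat -> ncf_digit a (S k + i) = RR) ->
  ncf_digit a (S k + n) = (RR + 1)%Z ->
  (forall i, (i < n)%nat -> ncf_digit a (S (S k + n) + i) = RR) ->
  (4 * IZR RR + 20) * ((2 * IZR RR + 4) / 2 ^ n) < 3 * (Cc - climit b) ->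
  (2 * IZR RR + 4) / 2 ^ n <= 1 -> False.
Proof.
intros HE Hk Hn Dl Dc Dr Hsmall Hh1.
set (c := (S k + n)%nat) in *. assert (Ec : S (k + n) = c) by (unfold c; lia).
set (h := (2 * IZR RR + 4) / 2 ^ n) in *.
assert (Hr := r_ge4). destruct delta_fix as [F1 [F2 F3]].
assert (P6 : 0 < 2 ^ n) by (apply pow_lt; lra).
assert (H4h : (/ 4) ^ n <= h).
{ unfold h. apply Rle_trans with (/ 2 ^ n).
  - rewrite pow_inv. apply Rinv_le_contravar; [exact P6|]. apply pow_incr. lra.
  - unfold Rdiv. rewrite <- (Rmult_1_l (/ 2 ^ n)) at 1.
    apply Rmult_le_compat_r; [left; now apply Rinv_0_lt_compat|lra]. }
assert (Hh0 : 0 <= h) by (apply Rle_trans with (2 := H4h); apply pow_le; lra).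
destruct (cell_exists (k + n) ltac:(lia)) as [x0 [y0 C0]].
destruct (cell_exists c ltac:(lia)) as [x1 [y1 C1]].
destruct (cell_exists (S c) ltac:(lia)) as [x2 [y2 C2]].
destruct (cell_exists (S (S c)) ltac:(lia)) as [x3 [y3 C3]].
assert (C1' := C1). rewrite <- Ec in C1'.
destruct (cell_link _ _ _ _ _ C0 C1') as [t' L0].
destruct (cell_link _ _ _ _ _ C1 C2) as [t0 L1].
destruct (cell_link _ _ _ _ _ C2 C3) as [t L2].
assert (X1 := left_tail n k t' x0 y0 x1 y1 HE Hk Dl C0 C1' L0).
assert (Y2 := right_tail n (S c) t x2 y2 x3 y3 HE ltac:(lia) Dr C2 C3 L2).
fold h in X1, Y2.
assert (D0 : ncf_digit a (k + n) = RR).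
{ replace (k + n)%nat with (S k + (n - 1))%nat by lia. apply Dl. lia. }
assert (D2 : ncf_digit a (S c) = RR).
{ rewrite <- (Nat.add_0_r (S c)). apply Dr. lia. }
assert (S1 := link_sum_odd (k + n) t' t0 x0 y0 x1 y1 x2 y2 HE ltac:(lia) C0 C1').
rewrite Ec in S1. specialize (S1 C2 L0 L1 ltac:(lia)).
assert (S2 := link_sum_odd c t0 t x1 y1 x2 y2 x3 y3 HE ltac:(lia) C1 C2 C3 L1 L2 ltac:(lia)).
assert (Et' := digit_parity_even _ _ _ _ _ _ HE D0 L0).
assert (Et := digit_parity_even _ _ _ _ _ _ HE D2 L2).
assert (Bt0 := link_bound c t0 x1 y1 x2 y2 ltac:(lia) C1 C2 L1).
destruct (cell_half c x1 y1 ltac:(lia) C1) as [Bx1 By1].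
destruct (cell_half (S c) x2 y2 ltac:(lia) C2) as [Bx2 By2].
assert (Gb := back_gap n (S k) Dl). fold c in Gb.
assert (Ga := state_gap n (S c) Dr).
destruct (cell_corners c x1 y1 ltac:(lia) C1) as [K1 K2].
destruct (cell_corners (S c) x2 y2 ltac:(lia) C2) as [K3 K4].
destruct L1 as [Lx [Ly _]].
assert (A1 := state_range c). assert (A2 := state_range (S c)).
assert (B1 := back_bounds c). assert (B2 := back_bounds (S c)). assert (B3 := back_pos c).
assert (A3 := state_le c). assert (A4 := state_le (S c)).
assert (E1 := state_step c). assert (E2 := back_step c).
unfold dig in E1, E2. rewrite Dc in E1, E2.
assert (EA : IZR (RR + 1) = IZR RR + 1) by apply plus_IZR.
assert (le_delta : forall p q, 0 < p -> 0 <= q <= b -> p * (IZR (RR + 1) - q) = 1 -> p <= dl).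
{ intros p q Hp Hq Hpq. rewrite EA in Hpq.
  apply Rmult_le_reg_r with (IZR RR + 1 - b); [lra|]. rewrite F3, <- Hpq.
  apply Rmult_le_compat_l; lra. }
assert (L3 := le_delta (al c) (al (S c)) ltac:(lra) ltac:(lra) E1).
assert (L4 := le_delta (ab (S c)) (ab c) ltac:(lra) ltac:(lra) E2).
assert (G3 := delta_gap (RR + 1) (al c) (al (S c)) h ltac:(lra) ltac:(lra) EA E1 ltac:(lra)).
assert (G4 := delta_gap (RR + 1) (ab (S c)) (ab c) h ltac:(lra) ltac:(lra) EA E2 ltac:(lra)).
assert (Hcl := climit_pos b Hb). assert (Hlim := delta_climit).
set (d := dl) in *. clearbody d.
assert (Hdb : d * b <= 0.268 * 0.268) by (apply Rmult_le_compat; lra).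
(* The main term is [delta_climit]. As [d * b < 0.1], raising [climit b] to [Cc] gains at least
   [3.6] times the difference, of which 3 is kept. *)
assert (Hgap : forall p q, 0 <= p <= d -> 0 <= q <= b -> 4 * Cc * (1 - p * q) >=
  (1 - b) * (1 - 2 * d) + 3 * (Cc - climit b)).
{ intros p q Hp Hq. assert (p * q <= d * b) by (apply Rmult_le_compat; lra).
  assert (4 * Cc * (1 - d * b) <= 4 * Cc * (1 - p * q)) by (apply Rmult_le_compat_l; lra).
  assert (0 <= (Cc - climit b) * (0.1 - d * b)) by (apply Rmult_le_pos; lra).
  lra. }
assert (K5 := Hgap (al c) (ab c) ltac:(lra) ltac:(lra)).
assert (K6 := Hgap (ab (S c)) (al (S c)) ltac:(lra) ltac:(lra)).
rewrite (Rmult_comm (ab (S c))) in K6.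
assert (Hd1 : d * (1 + b) = b) by lra.
assert (perturb : forall p q x z u v w : R, Rabs (p - b) <= h -> Rabs (q - d) <= h ->
  Rabs (x - u * d) <= h -> Rabs (z - w * d) <= h -> Rabs z <= / 2 -> Rabs v <= IZR RR ->
  0 <= p <= 1 -> 0 <= q <= 1 -> Rabs x <= / 2 -> Rabs (q * (v + z)) <= / 2 ->
  (1 - p - x) * (1 - q - q * (v + z)) <=
    (1 - b - u * d) * (1 - d - d * (v + w * d)) + 3 * (Cc - climit b) /\
  (1 - p + x) * (1 - q + q * (v + z)) <=
    (1 - b - - u * d) * (1 - d - d * (- v + - w * d)) + 3 * (Cc - climit b)).
{ intros p q x z u v w H1 H2 H3 H4 H5 H6 H7 H8 H9 H10. split.
  - eapply Rle_trans; [apply (corner_perturb b d h (IZR RR) p q x z u v w)|]; try lra.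
    + apply Rabs_le. apply Rabs_le_between in H9. lra.
    + apply Rabs_le. apply Rabs_le_between in H10. lra.
  - replace ((1 - p + x) * (1 - q + q * (v + z)))
      with ((1 - p - - x) * (1 - q - q * (- v + - z))) by ring.
    eapply Rle_trans; [apply (corner_perturb b d h (IZR RR) p q (- x) (- z) (- u) (- v) (- w))|];
      rewrite ?Rabs_Ropp; try lra.
    + replace (- x - - u * d) with (- (x - u * d)) by ring. now rewrite Rabs_Ropp.
    + replace (- z - - w * d) with (- (z - w * d)) by ring. now rewrite Rabs_Ropp.
    + apply Rabs_le. apply Rabs_le_between in H9. lra.
    + replace (q * (- v + - z)) with (- (q * (v + z))) by ring.
      apply Rabs_le. apply Rabs_le_between in H10. lra. }
(* If [t' = 0] and [t <> 0], the expansion is read backwards: the cell at [S c] is used, with [al]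
   and [ab] exchanged. *)
assert (Hcase : (t' <> 0 \/ t = 0)%Z \/ (t <> 0 \/ t' = 0)%Z) by lia.
destruct Hcase as [Hcase|Hcase].
- assert (M := central_corner_le b d t' t0 t Hb Hd1 Et' S1 S2 Hcase).
  rewrite Ly in K1, K2, By1.
  destruct (perturb (ab c) (al c) x1 y2 (IZR t') (IZR t0) (IZR t)) as [M1 M2]; try lra.
- assert (M := central_corner_le b d t t0 t' Hb Hd1 Et ltac:(lia) ltac:(lia) Hcase).
  rewrite Lx in K3, K4, Bx2.
  destruct (perturb (al (S c)) (ab (S c)) y2 x1 (IZR t) (IZR t0) (IZR t')) as [M1 M2]; try lra.
Qed.

End Cells.

(** * Upper bound for every shift *)

Lemma Rbar_lub_spec E : Rbar_is_lub E (Rbar_lub E).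
Proof. unfold Rbar_lub. now destruct (Rbar_ex_lub E). Qed.

Lemma Rbar_glb_spec E : Rbar_is_glb E (Rbar_glb E).
Proof. unfold Rbar_glb. now destruct (Rbar_ex_glb E). Qed.

Lemma dnint_pos_of_notin (n : Z) : ~ (exists m n : Z, g = IZR m + a * IZR n) ->
  0 < dnint (IZR n * a - g).
Proof.
intros Hg. destruct (dnint_attained (IZR n * a - g)) as [m ->].
apply Rabs_pos_lt. intros E. apply Hg. exists (- m)%Z, n. rewrite opp_IZR. lra.
Qed.

Lemma dnint_lower_bound (N : nat) : ~ (exists m n : Z, g = IZR m + a * IZR n) ->
  exists mu, 0 < mu /\ forall n : Z, (Z.abs n < Z.of_nat N)%Z -> mu <= dnint (IZR n * a - g).
Proof.
intros Hg. induction N as [|N [mu [H1 H2]]].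
- exists 1. split; [lra|]. intros n Hn. lia.
- exists (Rmin mu (Rmin (dnint (IZR (Z.of_nat N) * a - g)) (dnint (IZR (- Z.of_nat N) * a - g)))).
  split.
  + apply Rmin_glb_lt; [exact H1|]. apply Rmin_glb_lt; now apply dnint_pos_of_notin.
  + intros n Hn.
    assert (Z.abs n < Z.of_nat N \/ n = Z.of_nat N \/ n = - Z.of_nat N)%Z as [H|[->| ->]] by lia.
    * apply Rle_trans with (1 := Rmin_l _ _). now apply H2.
    * apply Rle_trans with (1 := Rmin_r _ _). apply Rmin_l.
    * apply Rle_trans with (1 := Rmin_r _ _). apply Rmin_r.
Qed.

Context (l : nat) (HE : Z.Even RR) (Hl : (1 <= l)%nat)
  (Hper : forall k, ncf_digit a k = if Nat.eqb (k mod (l + 1)) 0 then (RR + 1)%Z else RR).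

Lemma digit_odd j : ncf_digit a (j * (l + 1)) = (RR + 1)%Z.
Proof. rewrite Hper, Nat.Div0.mod_mul. reflexivity. Qed.

Lemma digit_even j i : (i < l)%nat -> ncf_digit a (S (j * (l + 1)) + i) = RR.
Proof.
intros Hi. rewrite Hper. replace (S (j * (l + 1)) + i)%nat with (S i + j * (l + 1))%nat by lia.
rewrite Nat.Div0.mod_add, Nat.mod_small by lia. reflexivity.
Qed.

Lemma Mag_le (eps : R) : 0 < eps -> ~ (exists m n : Z, g = IZR m + a * IZR n) ->
  (4 * IZR RR + 20) * ((2 * IZR RR + 4) / 2 ^ l) < 3 * eps -> (2 * IZR RR + 4) / 2 ^ l <= 1 ->
  Rbar_le (Mag a g) (climit b + eps).
Proof.
intros Heps Hg Hsmall Hh. unfold Mag.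
apply (proj2 (Rbar_lub_spec _)). intros y [N ->].
assert (Hex : exists n : Z, (Z.of_nat N <= Z.abs n)%Z /\
  Rabs (IZR n) * dnint (IZR n * a - g) <= climit b + eps).
{ apply NNPP. intros Hno.
  assert (Hfar : forall n : Z, (Z.of_nat N <= Z.abs n)%Z ->
    climit b + eps < Rabs (IZR n) * dnint (IZR n * a - g)).
  { intros n Hn. apply Rnot_le_lt. intros Hle. apply Hno. now exists n. }
  (* The finitely many [n] below [N] keep distance [mu]. Once [b ^ k < mu / 3], a grid point with
     [|v| <= 3] is closer than that, so its [n] is at least [N] in modulus. *)
  destruct (dnint_lower_bound N Hg) as [mu [Hmu1 Hmu2]].
  destruct (pow_lt_1_zero b) with (y := mu / 3) as [k1 Hk1]; [rewrite Rabs_pos_eq; lra|lra|].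
  apply (odd_digit_contradiction (climit b + eps) (S k1)) with (k := (k1 * (l + 1) + (l + 1))%nat) (n := l);
    auto; try lra; try lia.
  - intros k u v Hk [n [m [G1 G2]]] Hv.
    assert (HQ := qden_pos k). assert (HEp := qerr_pos k). assert (HEl := qerr_le k).
    assert (Hbk := Hk1 k ltac:(lia)). rewrite Rabs_pos_eq in Hbk; [|apply pow_le; lra].
    assert (HQE := qden_mul_qerr k).
    assert (Hd : dnint (IZR n * a - g) <= qerr a k * Rabs v).
    { rewrite <- (Rabs_pos_eq (qerr a k)), <- Rabs_mult, <- G2; [|lra].
      replace (IZR n * a - IZR m - g) with (IZR n * a - g - IZR m) by ring. apply dnint_le. }
    assert (Hd3 : qerr a k * Rabs v <= qerr a k * 3) by (apply Rmult_le_compat_l; lra).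
    assert (Hn : (Z.of_nat N <= Z.abs n)%Z).
    { destruct (Z_lt_le_dec (Z.abs n) (Z.of_nat N)) as [H|H]; [|exact H].
      assert (Hmu := Hmu2 n H). lra. }
    assert (HF := Hfar n Hn). rewrite G1 in HF at 1.
    rewrite Rabs_mult, (Rabs_pos_eq (qden a k)) in HF; [|lra].
    assert (HF2 : climit b + eps < qden a k * qerr a k * Rabs (u * v)).
    { apply Rlt_le_trans with (1 := HF). rewrite Rabs_mult.
      replace (qden a k * qerr a k * (Rabs u * Rabs v))
        with (qden a k * Rabs u * (qerr a k * Rabs v)) by ring.
      apply Rmult_le_compat_l; [|exact Hd]. apply Rmult_le_pos; [lra|apply Rabs_pos]. }
    assert (Hp : 0 < 1 - al k * ab k).
    { assert (A1 := state_le k). assert (A2 := state_range k). assert (A3 := back_bounds k). nra. }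
    apply Rlt_le_trans with (qden a k * qerr a k * Rabs (u * v) * (1 - al k * ab k)).
    + now apply Rmult_lt_compat_r.
    + apply Req_le. transitivity (qden a k * qerr a k * (1 - al k * ab k) * Rabs (u * v)); [ring|].
      rewrite HQE. ring.
  - intros i Hi. replace (k1 * (l + 1) + (l + 1))%nat with ((S k1) * (l + 1))%nat by lia.
    now apply digit_even.
  - replace (S (k1 * (l + 1) + (l + 1)) + l)%nat with ((S (S k1)) * (l + 1))%nat by lia.
    apply digit_odd.
  - intros i Hi.
    replace (S (k1 * (l + 1) + (l + 1)) + l)%nat with ((S (S k1)) * (l + 1))%nat by lia.
    now apply digit_even. }
destruct Hex as [n [Hn1 Hn2]].
apply Rbar_le_trans with (Finite (Rabs (IZR n) * dnint (IZR n * a - g))); [|exact Hn2].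
apply (proj1 (Rbar_glb_spec _)). now exists n.
Qed.

(** * Periodic expansion and the extremal shift *)

Lemma state_close n k k' : (forall i, (i < n)%nat -> ncf_digit a (k + i) = ncf_digit a (k' + i)) ->
  Rabs (al k - al k') <= (/ 4) ^ n.
Proof.
revert k k'. induction n as [|n IH]; intros k k' Hd.
- assert (H := state_range k). assert (H' := state_range k'). apply Rabs_le. simpl. lra.
- assert (A := state_range k). assert (A' := state_range k').
  assert (B := state_le k). assert (B' := state_le k').
  assert (E := state_step k). assert (E' := state_step k').
  assert (D := Hd 0%nat ltac:(lia)). rewrite !Nat.add_0_r in D.
  unfold dig in E, E'. rewrite D in E.
  assert (Q : al k - al k' = (al k * al k') * (al (S k) - al (S k'))).
  { transitivity (al k * (al k' * (IZR (ncf_digit a k') - al (S k')))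
      - al k' * (al k * (IZR (ncf_digit a k') - al (S k)))); [rewrite E, E'|]; ring. }
  rewrite Q, Rabs_mult, Rabs_pos_eq; [|nra]. cbn [pow].
  apply Rmult_le_compat; [nra|apply Rabs_pos|nra|].
  apply IH. intros i Hi. replace (S k + i)%nat with (k + S i)%nat by lia.
  replace (S k' + i)%nat with (k' + S i)%nat by lia. apply Hd. lia.
Qed.

Lemma state_periodic j i : al (j * (l + 1) + i) = al i.
Proof.
apply Rminus_diag_uniq. apply NNPP. intros Hne. apply Rabs_pos_lt in Hne.
destruct (pow_lt_1_zero (/ 4)) with (2 := Hne) as [n Hn]; [rewrite Rabs_pos_eq; lra|].
specialize (Hn n (Nat.le_refl n)). rewrite Rabs_pos_eq in Hn; [|apply pow_le; lra].
apply (Rlt_irrefl ((/ 4) ^ n)). apply Rlt_le_trans with (1 := Hn).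
apply state_close. intros s _. rewrite !Hper.
replace (j * (l + 1) + i + s)%nat with (i + s + j * (l + 1))%nat by lia.
now rewrite Nat.Div0.mod_add.
Qed.

Local Notation sg := altsign.
Local Notation td := (spike l).
Local Notation X := (spike_x a l).
Local Notation Y := (spike_y a l).
Local Notation P := (qerr a (l + 1)).
Local Notation y0 := (a / (1 + qerr a (l + 1))).

Lemma spike_odd j : td (j * (l + 1)) = sg j.
Proof. unfold spike. now rewrite Nat.Div0.mod_mul, Nat.div_mul by lia. Qed.

Lemma spike_even j i : (i < l)%nat -> td (j * (l + 1) + S i) = 0%Z.
Proof.
intros Hi. unfold spike. replace (j * (l + 1) + S i)%nat with (S i + j * (l + 1))%nat by lia.
now rewrite Nat.Div0.mod_add, Nat.mod_small by lia.
Qed.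

Lemma spike_parity k : Z.Even (td k - ncf_digit a k).
Proof.
unfold spike. rewrite Hper. destruct HE as [w ->].
destruct (Nat.eqb (k mod (l + 1)) 0); [|exists (- w)%Z; lia].
unfold altsign. destruct (Nat.even (k / (l + 1))); [exists (- w)%Z|exists (- w - 1)%Z]; lia.
Qed.

(** The choice of [y0] gives [y0 / a - 1 = - y0 * P / a] at a spike. Then [Y] is only divided by
    successive states, that is by the ratios of [qerr], until [P] cancels at the end of the period
    and the sign has flipped. *)
Lemma spike_y_values j : Y (j * (l + 1)) = IZR (sg j) * y0 /\
  forall i, (i <= l)%nat -> Y (j * (l + 1) + S i) = - IZR (sg j) * y0 * P / qerr a (S i).
Proof.
assert (HP := qerr_pos (l + 1)).
assert (inner : forall j, Y (j * (l + 1)) = IZR (sg j) * y0 ->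
  forall i, (i <= l)%nat -> Y (j * (l + 1) + S i) = - IZR (sg j) * y0 * P / qerr a (S i)).
{ intros j' H0 i. induction i as [|i IH]; intros Hi; rewrite Nat.add_succ_r; cbn [spike_y].
  - rewrite Nat.add_0_r, H0, spike_odd. rewrite <- (Nat.add_0_r (j' * (l + 1))), state_periodic.
    cbn [ncf_state qerr]. field. lra.
  - rewrite IH by lia. rewrite spike_even, state_periodic by lia.
    assert (H1 := qerr_pos (S i)). assert (H2 := state_range (S i)).
    change (qerr a (S (S i))) with (qerr a (S i) * al (S i)). field. lra. }
induction j as [|j [IH1 IH2]].
- assert (H : Y (0 * (l + 1)) = IZR (sg 0) * y0) by (change (y0 = 1 * y0); ring). split; auto.
- assert (H : Y (S j * (l + 1)) = IZR (sg (S j)) * y0).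
  { replace (S j * (l + 1))%nat with (j * (l + 1) + S l)%nat by lia.
    rewrite IH2 by lia. replace (S l) with (l + 1)%nat by lia.
    rewrite altsign_S, opp_IZR. field. lra. }
  split; auto.
Qed.

(** The sign is constant between spikes. The factor [b] away from the spike is the damping
    alternative in [corner_ge]. *)
Lemma spike_x_bounds j i : (i <= l)%nat ->
  0 <= IZR (sg j) * X (j * (l + 1) + S i) <= ab (j * (l + 1) + S i) * (if i then 1 else b).
Proof.
assert (inner : forall j, 0 <= IZR (sg j) * X (S (j * (l + 1))) <= ab (S (j * (l + 1))) ->
  forall i, (i <= l)%nat ->
  0 <= IZR (sg j) * X (j * (l + 1) + S i) <= ab (j * (l + 1) + S i) * (if i then 1 else b)).
{ intros j' H0 i'. induction i' as [|i' IH]; intros Hi.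
  - rewrite Nat.add_1_r. lra.
  - rewrite Nat.add_succ_r. cbn [spike_x]. rewrite spike_even by lia.
    specialize (IH ltac:(lia)).
    assert (B := back_bounds (j' * (l + 1) + S i')).
    assert (B' := back_pos (j' * (l + 1) + S i')).
    set (z := ab (S (j' * (l + 1) + S i'))) in *. set (w := ab (j' * (l + 1) + S i')) in *.
    set (x := X (j' * (l + 1) + S i')) in *.
    replace (IZR (sg j') * (z * (0 + x))) with (z * (IZR (sg j') * x)) by ring.
    assert (IZR (sg j') * x <= b) by (destruct i'; nra).
    split; [apply Rmult_le_pos; lra|]. apply Rmult_le_compat_l; lra. }
revert i. induction j as [|j IH]; apply inner.
- simpl Nat.mul. cbn [spike_x]. change (spike l 0) with (td (0 * (l + 1))). rewrite spike_odd.
  assert (B := back_pos 0). change (sg 0) with 1%Z. lra.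
- cbn [spike_x]. rewrite spike_odd.
  specialize (IH l ltac:(lia)).
  replace (j * (l + 1) + S l)%nat with (S j * (l + 1))%nat in IH by lia.
  assert (B := back_bounds (S j * (l + 1))). assert (B' := back_pos (S j * (l + 1))).
  set (z := ab (S (S j * (l + 1)))) in *. set (x := X (S j * (l + 1))) in *.
  assert (IZR (sg j) * x <= 1) by (destruct l; nra).
  rewrite altsign_S, opp_IZR in *.
  replace (- IZR (sg j) * (z * (- IZR (sg j) + x)))
    with (z * (IZR (sg j) * IZR (sg j) - IZR (sg j) * x)) by ring.
  rewrite altsign_sqr. split; [apply Rmult_le_pos; lra|].
  rewrite <- (Rmult_1_r z) at 2. apply Rmult_le_compat_l; lra.
Qed.

(** [X] has the sign of [altsign j] and [Y] the opposite one, so in each corner one factor is only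
    enlarged and [corner_ge] handles the other. Its alternative [p <= d] occurs for [ab] just after
    the digit [RR + 1] ([i = 0]) and for [al] just before it ([i = l]). *)
Lemma spike_corners k : (1 <= k)%nat ->
  Rabs (X k) <= ab k /\ Rabs (Y k) <= al k /\
  4 * climit b * (1 - al k * ab k) <= (1 - ab k - X k) * (1 - al k - Y k) /\
  4 * climit b * (1 - al k * ab k) <= (1 - ab k + X k) * (1 - al k + Y k).
Proof.
intros Hk.
assert (Hk2 : exists j i, (i <= l)%nat /\ k = (j * (l + 1) + S i)%nat).
{ exists ((k - 1) / (l + 1))%nat, ((k - 1) mod (l + 1))%nat.
  assert (H := Nat.mod_upper_bound (k - 1) (l + 1) ltac:(lia)).
  assert (H' := Nat.div_mod_eq (k - 1) (l + 1)). lia. }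
destruct Hk2 as [j [i [Hi ->]]].
assert (Hx := spike_x_bounds j i Hi). destruct (spike_y_values j) as [_ HY].
specialize (HY i Hi). set (k := (j * (l + 1) + S i)%nat) in *.
assert (A1 := state_range k). assert (A2 := state_le k). assert (B1 := back_bounds k).
assert (Hs := altsign_sqr j).
assert (Ha1 := state_le 0). cbn [ncf_state] in Ha1.
assert (HP := qerr_pos (l + 1)).
assert (Hy0 : 0 < y0 <= a).
{ split; [apply Rdiv_lt_0_compat; lra|]. apply Rmult_le_reg_r with (1 + P); [lra|].
  unfold Rdiv. rewrite Rmult_assoc, Rinv_l by lra. nra. }
assert (Hd : b / (1 + b) * (1 + b) = b) by (field; lra).
set (d := b / (1 + b)) in *.
assert (Hdr : d * (IZR RR + 1 - b) = 1) by (apply delta_fix; auto).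
assert (odd_le : forall p q, 0 < p -> 0 <= q <= b -> p * (IZR (RR + 1) - q) = 1 -> p <= d).
{ intros p q Hp Hq Hpq. rewrite plus_IZR in Hpq. assert (Hr := r_ge4).
  apply Rmult_le_reg_r with (IZR RR + 1 - b); [lra|]. rewrite Hdr, <- Hpq.
  apply Rmult_le_compat_l; lra. }
assert (HyB : 0 <= - (IZR (sg j) * Y k) <= al k /\ (- (IZR (sg j) * Y k) <= al k * b \/ al k <= d)).
{ rewrite HY.
  replace (- (IZR (sg j) * (- IZR (sg j) * y0 * P / qerr a (S i))))
    with (IZR (sg j) * IZR (sg j) * (y0 * (P / qerr a (S i))))
    by (field; assert (H := qerr_pos (S i)); lra).
  rewrite Hs, Rmult_1_l.
  destruct (Nat.eq_dec i l) as [->|Hne].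
  - replace (P / qerr a (S l)) with 1 by (replace (S l) with (l + 1)%nat by lia; field; lra).
    assert (Hal : al k = a).
    { unfold k. replace (j * (l + 1) + S l)%nat with (S j * (l + 1) + 0)%nat by lia.
      rewrite state_periodic. reflexivity. }
    rewrite Hal. split; [lra|right].
    apply (odd_le a (al 1)); [lra| |].
    + assert (C1 := state_range 1). assert (C2 := state_le 1). lra.
    + assert (C := state_step 0). unfold dig in C. rewrite (digit_odd 0 : ncf_digit a 0 = _) in C.
      exact C.
  - assert (Hq : exists r, 0 <= r <= 1 /\ P / qerr a (S i) = al (S i) * r).
    { exists (P / qerr a (S (S i))). assert (Q1 := qerr_pos (S i)). assert (Q2 := qerr_pos (S (S i))).
      assert (C := state_range (S i)).
      split; [|change (qerr a (S (S i))) with (qerr a (S i) * al (S i)); field; lra].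
      split; [apply Rlt_le, Rdiv_lt_0_compat; lra|].
      apply Rmult_le_reg_r with (qerr a (S (S i))); [lra|].
      unfold Rdiv. rewrite Rmult_assoc, Rinv_l, Rmult_1_r, Rmult_1_l by lra.
      apply qerr_anti. lia. }
    destruct Hq as [r [Hr1 ->]].
    assert (Ek : al k = al (S i)) by apply state_periodic. rewrite <- Ek.
    assert (Hyr : 0 <= y0 * r <= b).
    { split; [apply Rmult_le_pos; lra|]. rewrite <- (Rmult_1_r b). apply Rmult_le_compat; lra. }
    replace (y0 * (al k * r)) with (al k * (y0 * r)) by ring.
    split; [split; [apply Rmult_le_pos; lra|]|left; apply Rmult_le_compat_l; lra].
    rewrite <- (Rmult_1_r (al k)) at 2. apply Rmult_le_compat_l; lra. }
assert (HxB : 0 <= IZR (sg j) * X k <= ab k /\ (IZR (sg j) * X k <= ab k * b \/ ab k <= d)).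
{ destruct i as [|i].
  - split; [lra|right]. unfold k. rewrite Nat.add_1_r.
    apply (odd_le _ (ab (j * (l + 1)))); [apply back_pos|apply back_bounds|].
    assert (C := back_step (j * (l + 1))). unfold dig in C. now rewrite digit_odd in C.
  - split; [|left; lra]. assert (ab k * b <= ab k * 1) by (apply Rmult_le_compat_l; lra). lra. }
clear HY Hx. clearbody k.
assert (Hc : 4 * climit b * (1 + b - b ^ 2) = (1 - b) ^ 2) by (unfold climit; field; nra).
assert (R1 := corner_ge b d (4 * climit b) (ab k) (al k) (IZR (sg j) * X k) Hb Hd Hc B1
  ltac:(lra) ltac:(lra) (proj2 HxB)).
assert (R2 := corner_ge b d (4 * climit b) (al k) (ab k) (- (IZR (sg j) * Y k)) Hb Hd Hc
  ltac:(lra) B1 ltac:(lra) (proj2 HyB)).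
rewrite (Rmult_comm (ab k)) in R2.
destruct HxB as [HxB _], HyB as [HyB _]. 
unfold altsign in *. destruct (Nat.even j); (split; [apply Rabs_le; lra|split; [apply Rabs_le; lra|]]);
  set (x := X k) in *; set (y := Y k) in *; set (p := al k) in *; set (q := ab k) in *.
- assert (0 <= (1 - q - x) * (- y)) by (apply Rmult_le_pos; lra).
  assert (0 <= (1 - p + y) * x) by (apply Rmult_le_pos; lra).
  split; lra.
- assert (0 <= (1 - q + x) * y) by (apply Rmult_le_pos; lra).
  assert (0 <= (1 - p - y) * (- x)) by (apply Rmult_le_pos; lra).
  split; lra.
Qed.

Local Notation g0 := ((y0 - a + 1) / 2).

Lemma spike_coords k (n m : Z) : exists I J : Z, Z.Odd I /\ Z.Odd J /\
  2 * IZR n = qden a k * (X k + IZR I + ab k * IZR J) /\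
  2 * (IZR n * a - IZR m - g0) = qerr a k * (al k * IZR I + IZR J - Y k).
Proof.
induction k as [|k [I [J [HI [HJ [H1 H2]]]]]].
(* With [X = -1] and [Y = y0] at stage 0, these odd coordinates are what fixes [g0]. *)
- exists (2 * n + 1)%Z, (- 2 * m - 1)%Z. split; [now exists n|]. split; [exists (- m - 1)%Z; lia|].
  rewrite plus_IZR, minus_IZR, !mult_IZR. cbn [spike_x spike_y qden qerr back ncf_state].
  assert (HP := qerr_pos (l + 1)). split; [ring|field; lra].
- exists (- J)%Z, (I + ncf_digit a k * J - td k)%Z.
  split; [destruct HJ as [j ->]; exists (- j - 1)%Z; lia|].
  split.
  { destruct HI as [i ->], HJ as [j ->], (spike_parity k) as [w Hw].
    exists (i + ncf_digit a k * j - w)%Z. lia. }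
  rewrite opp_IZR, minus_IZR, plus_IZR, mult_IZR. fold (dig a k).
  assert (E1 := state_step k). assert (E2 := back_step k). assert (A := state_range k). split.
  + rewrite H1, <- (qden_step k). cbn [spike_x].
    replace (qden a (S k) * ab (S k) * (X k + IZR I + ab k * IZR J))
      with (qden a (S k) * (ab (S k) * X k + ab (S k) * IZR I + ab (S k) * ab k * IZR J)) by ring.
    replace (ab (S k) * ab k) with (ab (S k) * dig a k - 1) by lra. ring.
  + rewrite H2. cbn [spike_y qerr].
    transitivity (qerr a k * (al k * IZR I + al k * (dig a k - al (S k)) * IZR J - Y k));
      [rewrite E1; ring|field; lra].
Qed.

(** Because [qerr a 1 = a], the stage found is at least 1, where [spike_corners] applies. *)
Lemma qerr_window z : 0 < z < a -> exists k, (1 <= k)%nat /\ qerr a (S k) <= z < qerr a k.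
Proof.
intros Hz. assert (H0 : exists k, qerr a (S k) <= z).
{ destruct (pow_lt_1_zero b) with (y := z) as [n Hn]; [rewrite Rabs_pos_eq; lra|lra|].
  exists n. specialize (Hn (S n) ltac:(lia)). rewrite Rabs_pos_eq in Hn; [|apply pow_le; lra].
  assert (H := qerr_le (S n)). lra. }
destruct H0 as [k Hk]. induction k as [|k IH].
- cbn [qerr ncf_state] in Hk. lra.
- destruct (Rle_or_lt (qerr a (S k)) z) as [H|H]; [now apply IH|]. exists (S k). split; [lia|lra].
Qed.

(** Otherwise some [n] has [V = 0] at all stages while [U = 2 * n / qden] tends to 0; but with
    [V = 0] an odd [I] keeps [U] away from 0. *)
Lemma spike_notin : ~ (exists m n : Z, g0 = IZR m + a * IZR n).
Proof.
intros [m [n Hg]].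
destruct (Pow_x_infinity 3) with (b := 4 * (Rabs (IZR n) + 1)) as [k0 Hk0]; [rewrite Rabs_pos_eq; lra|].
set (k := S k0). assert (Hk := Hk0 k ltac:(unfold k; lia)).
rewrite Rabs_pos_eq in Hk; [|apply pow_le; lra].
assert (HQ := qden_ge k).
destruct (spike_coords k n (- m)) as [I [J [[i HI] [_ [H1 H2]]]]].
destruct (spike_corners k ltac:(unfold k; lia)) as [Bx [By _]].
apply Rabs_le_between in Bx. apply Rabs_le_between in By.
assert (A1 := state_range k). assert (A2 := state_le k). assert (B1 := back_bounds k).
assert (HE0 := qerr_pos k).
assert (EV : al k * IZR I + IZR J - Y k = 0).
{ apply Rmult_eq_reg_l with (qerr a k); [|lra]. rewrite <- H2, Hg, opp_IZR. ring. }
set (U := X k + IZR I + ab k * IZR J) in *.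
assert (HU : Rabs U < / 2).
{ apply Rmult_lt_reg_l with (qden a k); [assert (H := qden_pos k); lra|].
  rewrite <- (Rabs_pos_eq (qden a k)) at 1; [|assert (H := qden_pos k); lra].
  rewrite <- Rabs_mult, <- H1, Rabs_mult, (Rabs_pos_eq 2); lra. }
assert (EI : IZR I * (1 - al k * ab k) = U - X k - ab k * Y k).
{ unfold U. replace (IZR J) with (Y k - al k * IZR I) by lra. ring. }
apply Rabs_def2 in HU.
assert (Hp : 0 <= al k * ab k <= 0.268 * 0.268) by (split; [nra|apply Rmult_le_compat; lra]).
assert (Hy : - (al k * ab k) <= ab k * Y k <= al k * ab k) by nra.
assert (I <= -1 \/ 1 <= I)%Z as [H|H] by lia; apply IZR_le in H.
- assert (IZR I * (1 - al k * ab k) <= -1 * (1 - al k * ab k)) by (apply Rmult_le_compat_r; lra). lra.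
- assert (1 * (1 - al k * ab k) <= IZR I * (1 - al k * ab k)) by (apply Rmult_le_compat_r; lra). lra.
Qed.

Lemma climit_le_Mag : Rbar_le (climit b) (Mag a g0).
Proof.
assert (Hc : 4 * climit b <= 1 - b).
{ unfold climit. apply Rmult_le_reg_r with (1 + b - b ^ 2); [nra|].
  replace (4 * ((1 - b) ^ 2 / (4 * (1 + b - b ^ 2))) * (1 + b - b ^ 2))
    with ((1 - b) ^ 2) by (field; nra). nra. }
(* This [N] settles the points with [2 * |z| >= a], where [|n| * |z| >= (2 / a) * (a / 2) = 1]. *)
destruct (archimed (2 / a)) as [HN _]. set (N := Z.to_nat (up (2 / a))).
assert (Hpos : 0 < 2 / a) by (apply Rdiv_lt_0_compat; lra).
assert (HN0 : (0 <= up (2 / a))%Z) by (apply le_IZR; lra).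
apply Rbar_le_trans with (tail_inf a g0 N); [|apply (proj1 (Rbar_lub_spec _)); now exists N].
apply (proj2 (Rbar_glb_spec _)). intros y [n [Hn ->]].
destruct (dnint_attained (IZR n * a - g0)) as [m Hm].
simpl. rewrite Hm.
replace (IZR n * a - g0 - IZR m) with (IZR n * a - IZR m - g0) by ring.
set (z := IZR n * a - IZR m - g0).
assert (Hz : 0 < Rabs z).
{ apply Rabs_pos_lt. unfold z. intros E. apply spike_notin. exists (- m)%Z, n. rewrite opp_IZR. lra. }
destruct (Rlt_le_dec (2 * Rabs z) a) as [Hza|Hza].
- destruct (qerr_window (2 * Rabs z)) as [k [Hk [W1 W2]]]; [lra|].
  destruct (spike_coords k n m) as [I [J [HI [HJ [H1 H2]]]]]. fold z in H2.
  destruct (spike_corners k Hk) as [Bx [By [C3 C1]]].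
  assert (A1 := state_range k). assert (A2 := state_le k). assert (B1 := back_bounds k).
  assert (HE0 := qerr_pos k). assert (HQ0 := qden_pos k). assert (HQE := qden_mul_qerr k).
  assert (Hp : 0 <= al k * ab k <= 0.268 * 0.268) by (split; [nra|apply Rmult_le_compat; lra]).
  set (V := al k * IZR I + IZR J - Y k) in *. set (U := X k + IZR I + ab k * IZR J) in *.
  assert (HzV : 2 * Rabs z = qerr a k * Rabs V).
  { rewrite <- (Rabs_pos_eq 2), <- Rabs_mult, H2, Rabs_mult, (Rabs_pos_eq (qerr a k)); lra. }
  assert (HV : al k <= Rabs V < 1).
  { cbn [qerr] in W1.
    split; apply Rmult_le_reg_l with (qerr a k) || apply Rmult_lt_reg_l with (qerr a k); lra. }
  assert (Hc0 := climit_pos b Hb).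
  assert (Hle : 4 * climit b * (1 - al k * ab k) <= Rabs (U * V)).
  { apply (window_product b); auto; try lra.
    assert (0 <= climit b * (al k * ab k)) by (apply Rmult_le_pos; lra). lra. }
  assert (HnU : 2 * Rabs (IZR n) = qden a k * Rabs U).
  { rewrite <- (Rabs_pos_eq 2), <- Rabs_mult, H1, Rabs_mult, (Rabs_pos_eq (qden a k)); lra. }
  assert (Hprod : 4 * (Rabs (IZR n) * Rabs z) = qden a k * qerr a k * Rabs (U * V)).
  { rewrite Rabs_mult. replace (4 * (Rabs (IZR n) * Rabs z))
      with (2 * Rabs (IZR n) * (2 * Rabs z)) by ring. rewrite HnU, HzV. ring. }
  apply Rmult_le_reg_l with 4; [lra|]. rewrite Hprod.
  apply Rle_trans with (qden a k * qerr a k * (4 * climit b * (1 - al k * ab k))).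
  + apply Req_le.
    transitivity (qden a k * qerr a k * (1 - al k * ab k) * (4 * climit b)); [rewrite HQE|]; ring.
  + apply Rmult_le_compat_l; [|exact Hle]. apply Rmult_le_pos; lra.
- assert (Hn2 : 2 / a <= Rabs (IZR n)).
  { rewrite <- abs_IZR. apply Rle_trans with (IZR (up (2 / a))); [lra|].
    apply IZR_le. unfold N in Hn. lia. }
  apply Rle_trans with (2 / a * (a / 2)).
  + replace (2 / a * (a / 2)) with 1 by (field; lra). lra.
  + apply Rmult_le_compat; lra.
Qed.

End Chain.

(** * Passage to the limit and closed forms of the constant *)

Lemma rho_between (RR : Z) (b a eps : R) (l : nat) : (4 <= RR)%Z -> Z.Even RR ->
  b * (IZR RR - b) = 1 -> 0 < b <= 0.268 -> 0 < a < 1 -> (1 <= l)%nat ->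
  (forall k, ncf_digit a k = if Nat.eqb (k mod (l + 1)) 0 then (RR + 1)%Z else RR) ->
  0 < eps -> (4 * IZR RR + 20) * ((2 * IZR RR + 4) / 2 ^ l) < 3 * eps ->
  (2 * IZR RR + 4) / 2 ^ l <= 1 ->
  Rbar_le (climit b) (rho a) /\ Rbar_le (rho a) (climit b + eps).
Proof.
intros H4 HE Hbr Hb Ha Hl Hper Heps Hsmall Hh.
assert (Hdig : forall k, (RR <= ncf_digit a k <= RR + 1)%Z).
{ intros k. rewrite Hper. destruct (Nat.eqb _ _); lia. }
split.
- apply Rbar_le_trans with (1 := climit_le_Mag RR b a H4 Hbr Hb Ha Hdig l HE Hl Hper).
  apply (proj1 (Rbar_lub_spec _)). eexists. split; [|reflexivity].
  exact (spike_notin RR b a H4 Hbr Hb Ha Hdig l HE Hl Hper).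
- apply (proj2 (Rbar_lub_spec _)). intros y [g [Hg ->]].
  now apply (Mag_le RR b a H4 Hbr Hb Ha Hdig g l HE Hl Hper).
Qed.

Lemma climit_delta (r b : R) : b * (r - b) = 1 -> 0 < b <= 0.268 ->
  (1 - 2 * / (r + 1 - b)) * (1 - b) / (4 * (1 - / (r + 1 - b) * b)) = climit b.
Proof.
intros H Hb. replace (/ (r + 1 - b)) with (b / (1 + b)).
- unfold climit. field. repeat split; nra.
- assert (0 < r + 1 - b) by nra. apply Rmult_eq_reg_r with (r + 1 - b); [|lra].
  rewrite Rinv_l by lra.
  replace (b / (1 + b) * (r + 1 - b)) with ((b * (r - b) + b) / (1 + b)) by (field; lra).
  rewrite H. field. lra.
Qed.

(** [1 + b ^ 2 = r * b] extracts a factor [b] from numerator and denominator; [r - 2 * b] is the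
    square root. *)
Lemma climit_sqrt (r b : R) : b * (r - b) = 1 -> 0 < b <= 0.268 ->
  climit b = / 4 * ((r - 2) / (r - 2 * b + 1)).
Proof.
intros H Hb. unfold climit.
assert (H1 : 0 < 1 + b - b ^ 2) by nra. assert (H2 : 0 < r - 2 * b + 1) by nra.
assert (E : (1 - b) ^ 2 = b * (r - 2)) by lra.
assert (E2 : 1 + b - b ^ 2 = b * (r - 2 * b + 1)) by lra.
rewrite E, E2. field. split; lra.
Qed.

(* alpha l = [0; overline{RR+1, RR, ..., RR}]^-  (period block: RR+1 then l copies of RR);
   ncf_digit a n is the digit a_{n+1}, so digit a_{k+1} with k mod (l+1) = 0 is RR+1. *)
Theorem theorem2 (RR : Z) (HR4 : (4 <= RR)%Z) (HReven : Z.Even RR)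
  (alpha : nat -> R)
  (Halpha_range : forall l : nat, (1 <= l)%nat -> 0 < alpha l < 1)
  (Halpha_digits : forall l : nat, (1 <= l)%nat -> forall k : nat,
      ncf_digit (alpha l) k =
        (if Nat.eqb (k mod (l + 1)) 0 then (RR + 1)%Z else RR)) :
  let beta := (IZR RR - sqrt (IZR RR ^ 2 - 4)) / 2 in
  let delta := / (IZR RR + 1 - beta) in
  let C := (1 - 2 * delta) * (1 - beta) / (4 * (1 - delta * beta)) in
  (forall eps : R, 0 < eps -> exists L : nat, forall l : nat, (L <= l)%nat ->
      exists r : R, rho (alpha l) = Finite r /\ Rabs (r - C) < eps)
  /\ C = / 4 * ((IZR RR - 2) / (sqrt (IZR RR ^ 2 - 4) + 1)).
Proof.
intros beta delta C.
assert (Hr : 4 <= IZR RR) by now apply IZR_le.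
destruct (small_root_bounds (IZR RR) beta Hr eq_refl) as [Hbr Hb].
assert (HC : C = climit beta) by exact (climit_delta (IZR RR) beta Hbr Hb).
split.
- intros eps Heps.
  (* Below this threshold the tail error is at most 1 and [4 * RR + 20] times it is at most [eps].
     The bounds of [rho_between] are not strict, hence its use with [eps / 2]. *)
  assert (Hbound : 0 < Rmin 1 (eps / (4 * IZR RR + 20)) / (2 * IZR RR + 4)).
  { apply Rdiv_lt_0_compat; [|lra]. apply Rmin_glb_lt; [lra|]. apply Rdiv_lt_0_compat; lra. }
  destruct (pow_lt_1_zero (/ 2)) with (2 := Hbound) as [L HL]; [rewrite Rabs_pos_eq; lra|].
  exists (S L). intros l Hl. specialize (HL l ltac:(lia)).
  rewrite Rabs_pos_eq in HL by (apply pow_le; lra). rewrite pow_inv in HL.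
  assert (Hh : (2 * IZR RR + 4) / 2 ^ l < Rmin 1 (eps / (4 * IZR RR + 20))).
  { apply Rmult_lt_compat_l with (r := 2 * IZR RR + 4) in HL; [|lra].
    replace ((2 * IZR RR + 4) * (Rmin 1 (eps / (4 * IZR RR + 20)) / (2 * IZR RR + 4)))
      with (Rmin 1 (eps / (4 * IZR RR + 20))) in HL by (field; lra). exact HL. }
  assert (M1 := Rmin_l 1 (eps / (4 * IZR RR + 20))).
  assert (M2 := Rmin_r 1 (eps / (4 * IZR RR + 20))).
  assert (Hsmall : (4 * IZR RR + 20) * ((2 * IZR RR + 4) / 2 ^ l) < 3 * (eps / 2)).
  { apply Rlt_trans with ((4 * IZR RR + 20) * (eps / (4 * IZR RR + 20))).
    - apply Rmult_lt_compat_l; lra.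
    - replace ((4 * IZR RR + 20) * (eps / (4 * IZR RR + 20))) with eps by (field; lra). lra. }
  destruct (rho_between RR beta (alpha l) (eps / 2) l HR4 HReven Hbr Hb (Halpha_range l ltac:(lia))
    ltac:(lia) (Halpha_digits l ltac:(lia)) ltac:(lra) Hsmall ltac:(lra)) as [R1 R2].
  destruct (rho (alpha l)) as [r| |]; simpl in R1, R2; try contradiction.
  exists r. split; [reflexivity|]. rewrite HC. apply Rabs_def1; lra.
- rewrite HC, (climit_sqrt (IZR RR) beta Hbr Hb). unfold beta.
  replace (IZR RR - 2 * ((IZR RR - sqrt (IZR RR ^ 2 - 4)) / 2)) with (sqrt (IZR RR ^ 2 - 4)) by field.
  reflexivity.
Qed.
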